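(* Let $U$ be the open unit disk in $\mathbb{C}$ and let $\varphi:U\to U$ be holomorphic. Then the composition operator $C_\varphi$ is hypercyclic on $H(U)$ if and only if $C_\varphi$ is weakly hypercyclic on $H(U)$.
   Context: $H(U)$ is the space of all complex-valued holomorphic functions on $U$, with its usual topology of uniform convergence on compact subsets of $U$. The composition operator $C_\varphi:H(U)\to H(U)$ is $C_\varphi(f)=f\circ\varphi$. A continuous linear operator $T$ on a topological vector space $X$ is hypercyclic if there is $x\in X$ whose orbit $\{T^nx:n\ge 0\}$ is dense in $X$ for the original topology, and weakly hypercyclic if there is $x\in X$ whose orbit is dense in $X$ for the weak topology. *)

(* Defs.v *)
From HB Require Import structures.
From mathcomp Require Import all_boot all_order all_algebra.
From mathcomp Require Import complex.
From mathcomp Require Import all_classical all_reals all_analysis.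

Set Implicit Arguments.
Unset Strict Implicit.
Unset Printing Implicit Defensive.

Import Order.TTheory GRing.Theory Num.Theory.
Import numFieldNormedType.Exports.

Local Open Scope classical_set_scope.
Local Open Scope ring_scope.

Section weak_topology_of_tvs.
Variables (K : numFieldType) (E : topologicalLmodType K).

Definition topological_dual : Type :=
  {f : {linear E -> K^o} | continuous (f : E -> K^o)}.

(* [E] with the coarsest topology making every element of the dual continuous *)
Definition weak_space : Type := sup_topology
  (fun f : topological_dual =>
     Topological.class (initial_topology (sval f : E -> K^o))).

HB.instance Definition _ := Topological.on weak_space.

Lemma weak_cvgP (F : set_system E) (x : E) : Filter F ->
  F --> (x : weak_space) <->
  forall f : topological_dual, sval f @ F --> (sval f x : K^o).
Proof.
move=> FF; split=> [/cvg_sup Fx f A fxA|Fx].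
  have := @initial_continuous E K^o (sval f) x A fxA.
  exact: Fx.
apply/cvg_sup => f A [_ [[B oB <-] Bfx] /filterS]; apply.
by apply: Fx; exact: open_nbhs_nbhs.
Qed.

End weak_topology_of_tvs.

Section hypercyclicity.
Variables (K : numFieldType) (E : topologicalLmodType K).

Definition operator_orbit (T : E -> E) (x : E) : set E :=
  [set iter n T x | n in [set: nat]].

Definition hypercyclic (T : {linear E -> E}) : Prop :=
  continuous T /\ exists x : E, dense (operator_orbit T x).

Definition weakly_hypercyclic (T : {linear E -> E}) : Prop :=
  continuous T /\
  exists x : E, dense (operator_orbit T x : set (weak_space E)).

End hypercyclicity.

Definition unit_disk (R : realType) : set R[i]^o := [set z | `|z| < 1].
Arguments unit_disk R : clear implicits.

Section holomorphic_functions.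
Variable R : realType.
Local Notation C := (R[i]^o).
Local Notation U := (set_type (unit_disk R)).

(* ['valL_ 0] extends [f] by 0 outside the disk; since the disk is open, this
   does not affect complex differentiability at its points. *)
Definition holomorphic : set (U -> C) :=
  [set f | forall z : U, derivable ('valL_ (0 : C) f) (\val z) 1].

Lemma valLE (f : U -> C) (z : U) : 'valL_ (0 : C) f (\val z) = f z.
Proof. by have /(congr1 (@^~ z)) := valLK (0 : C) f. Qed.

Lemma valL_linear (a : C) (f g : U -> C) :
  'valL_ (0 : C) (a *: f + g) = a *: 'valL_ (0 : C) f + 'valL_ (0 : C) g.
Proof.
apply/funext => z; rewrite !fctE /valL_ /=.
by case: ('oinv_set_val z) => [y|] //=; rewrite scaler0 addr0.
Qed.

Lemma open_unit_disk : open (unit_disk R).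
Proof.
suff -> : unit_disk R = ball (0 : C) 1 by exact: ball_open.
by apply/funext => z; rewrite -ball_normE /= sub0r normrN.
Qed.

Lemma near_unit_disk (z : U) : \forall w \near \val z, unit_disk R w.
Proof. by apply: open_nbhs_nbhs; split; [exact: open_unit_disk|exact: set_valP]. Qed.

Lemma holomorphic_continuous (f : U -> C) : holomorphic f -> continuous f.
Proof.
move=> hf z; rewrite /continuous_at.
have -> : f = 'valL_ (0 : C) f \o \val.
  by apply/funext => w; exact/esym/valLE.
apply: continuous_comp; first exact: initial_continuous.
by have /derivable1_diffP/differentiable_continuous := hf z.
Qed.

Lemma holomorphic_comp (f : U -> C) (phi : U -> U) :
  holomorphic f -> holomorphic (\val \o phi : U -> C) -> holomorphic (f \o phi).
Proof.
move=> hf hphi z.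
have : derivable ('valL_ (0 : C) f \o 'valL_ (0 : C) (\val \o phi)) (\val z) 1.
  apply/derivable1_diffP/differentiable_comp.
    by apply/derivable1_diffP; exact: hphi.
  by rewrite valLE; apply/derivable1_diffP; exact: hf.
apply: near_eq_derivable.
near=> w.
have Uw : w \in unit_disk R by apply/mem_set; near: w; exact: near_unit_disk.
have e (g : U -> C) : 'valL_ (0 : C) g w = g (SigSub Uw).
  exact: (valLE g (SigSub Uw)).
apply: etrans (esym (e _)).
rewrite -[LHS]/('valL_ (0 : C) f ('valL_ (0 : C) (\val \o phi) w)) e.
exact: valLE.
Unshelve. all: by end_near. Qed.

Definition hol_pred : {pred (U -> C)} := [pred f | f \in holomorphic].

Lemma hol_pred_submod_closed : submod_closed hol_pred.
Proof.
split=> [|a f g].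
  apply/mem_set => z; have -> : 'valL_ (0 : C) (0 : U -> C) = cst 0.
    by apply/funext => w; rewrite /valL_ /=; case: ('oinv_set_val w).
  exact: derivable_cst.
move=> /set_mem hf /set_mem hg; apply/mem_set => z.
by rewrite valL_linear; apply: derivableD; [apply: derivableZ; exact: hf|exact: hg].
Qed.

HB.instance Definition _ :=
  GRing.isSubmodClosed.Build R[i] (U -> C) hol_pred hol_pred_submod_closed.

Definition Hol : Type := {f : U -> C | f \in hol_pred}.

HB.instance Definition _ := [isSub of Hol for @sval _ _].
HB.instance Definition _ := [Choice of Hol by <:].
HB.instance Definition _ := [SubChoice_isSubLmodule of Hol by <:].

(* uniform convergence on the compact subsets of the disk *)
HB.instance Definition _ := Topological.copy Hol
  (initial_topology (\val : Hol -> {family compact, U -> C})).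

Lemma Hol_continuous (T : topologicalType) (G : T -> Hol) :
  (forall (t : T) (K : set U) (e : C), compact K -> 0 < e ->
    \forall s \near t, forall y, K y -> `|\val (G t) y - \val (G s) y| < e) ->
  continuous G.
Proof.
move=> GP; apply: continuous_comp_initial => t.
apply/fam_cvgP => K cK A /uniform_nbhs[E [entE EA]].
move: entE; rewrite -entourage_ballE => -[e /= e0 eE].
have := GP t K e cK e0; apply: filterS => s Gs.
by apply: EA => y Ky; apply: eE => /=; rewrite -ball_normE; exact: Gs.
Qed.

Lemma nbhs_Hol (f : Hol) (K : set U) (e : C) : compact K -> 0 < e ->
  \forall g \near f, forall y, K y -> `|\val f y - \val g y| < e.
Proof.
move=> cK e0.
apply: (@initial_continuous Hol {family compact, U -> C} \val f
  [set g | forall y, K y -> `|\val f y - g y| < e]).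
have := @fam_nbhs U C compact K [set xy | ball xy.1 e xy.2] (\val f)
  (entourage_ball _ (PosNum e0)) cK.
by apply: filterS => g gP y /gP; rewrite -ball_normE.
Qed.

Lemma Hol_add_continuous : continuous (fun x : Hol * Hol => x.1 + x.2).
Proof.
apply: Hol_continuous => -[f g] K e cK e0; near=> f' g' => /= y Ky.
rewrite !fctE opprD addrACA normm_lt_split//.
  by move: y Ky; near: f'; apply: nbhs_Hol => //; rewrite divr_gt0.
by move: y Ky; near: g'; apply: nbhs_Hol => //; rewrite divr_gt0.
Unshelve. all: by end_near. Qed.

HB.instance Definition _ :=
  PreTopologicalNmodule_isTopologicalNmodule.Build Hol Hol_add_continuous.

Lemma Hol_scale_continuous : continuous (fun z : R[i]^o * Hol => z.1 *: z.2).
Proof.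
apply: Hol_continuous => -[c f] K e cK e0.
have [M [M0 cM fM]] : exists M : C,
    [/\ 0 < M, `|c| < M & forall y, K y -> `|\val f y| < M].
  have bf : \forall M \near (+oo : set_system R[i]), forall y, K y -> `|\val f y| < M.
    move/compact_near_coveringP : cK; apply => y Ky.
    have cf : {for y, continuous (\val f)}.
      exact: (holomorphic_continuous (set_mem (valP f))).
    exists ([set y' | `|\val f y - \val f y'| < 1], [set M | `|\val f y| + 1 < M]).
      split; first by apply: (@cvgr_dist_lt _ C _ _ _ _ _ cf); exact: ltr01.
      by apply: nbhs_pinfty_gt; rewrite realD ?normr_real ?real1.
    move=> [y' M] /= [fy' yM]; apply: le_lt_trans yM.
    rewrite -[\val f y'](subKr (\val f y)) (le_trans (ler_normB _ _))//.
    by rewrite lerD2l ltW.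
  near (+oo : set_system R[i]) => M; exists M; split.
  - by near: M; exact: nbhs_pinfty_gt.
  - by near: M; apply: nbhs_pinfty_gt; exact: normr_real.
  - by near: M.
have M1 : 0 < M + 1 by rewrite addr_gt0.
near=> c' f' => /= y Ky.
have ff'1 : `|\val f y - \val f' y| < 1 by move: y Ky; near: f'; exact: nbhs_Hol.
have ff' : `|\val f y - \val f' y| < e / 2 / M.
  by move: y Ky {ff'1}; near: f'; apply: nbhs_Hol => //; rewrite !divr_gt0.
have cc' : `|c - c'| < e / 2 / (M + 1).
  by near: c'; apply: (@cvgr_dist_lt _ R[i]^o); rewrite ?divr_gt0.
have f'M : `|\val f' y| < M + 1.
  rewrite -[\val f' y](subKr (\val f y)) (le_lt_trans (ler_normB _ _))//.
  by rewrite ltrD// fM.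
rewrite !fctE (@distm_lt_split _ _ (c *: \val f' y))//.
  rewrite -scalerBr normrM (le_lt_trans (ler_wpM2r _ (ltW cM)))//.
  by rewrite mulrC -ltr_pdivlMr.
rewrite -scalerBl normrM (le_lt_trans (ler_wpM2l _ (ltW f'M)))//.
by rewrite -ltr_pdivlMr.
Unshelve. all: by end_near. Qed.

HB.instance Definition _ :=
  TopologicalNmodule_isTopologicalLmodule.Build R[i] Hol Hol_scale_continuous.

Section composition_operator.
Variables (phi : U -> U) (hphi : holomorphic (\val \o phi : U -> C)).

Definition comp_op (f : Hol) : Hol :=
  Sub (\val f \o phi) (mem_set (holomorphic_comp (set_mem (valP f)) hphi)).

Lemma comp_op_linear : linear comp_op.
Proof. by move=> a f g; apply/val_inj. Qed.

HB.instance Definition _ :=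
  GRing.isLinear.Build R[i] Hol Hol _ comp_op comp_op_linear.

Lemma comp_op_continuous : continuous comp_op.
Proof.
have cphi : continuous phi.
  apply: (@continuous_comp_initial _ U C \val phi).
  exact: holomorphic_continuous.
apply: Hol_continuous => f K e cK e0.
have : compact (phi @` K).
  by apply: continuous_compact => //; exact: continuous_subspaceT.
move=> cphiK; apply: filterS (nbhs_Hol f cphiK e0) => g gP y Ky.
by apply: gP; exists y.
Qed.

End composition_operator.

End holomorphic_functions.

(* Main.v *)
Require Import Defs.
From HB Require Import structures.
From mathcomp Require Import all_boot all_order all_algebra.
From mathcomp Require Import complex ring lra.
From mathcomp Require Import all_classical all_reals all_analysis.

Set Implicit Arguments.
Unset Strict Implicit.
Unset Printing Implicit Defensive.

Import Order.TTheory GRing.Theory Num.Theory.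
Import numFieldNormedType.Exports.
Import Normc.

Local Open Scope classical_set_scope.
Local Open Scope ring_scope.

(** A hypercyclic operator is weakly hypercyclic because the weak topology is
    the coarser one. For the converse, write T for composition with phi and let
    x have a weakly dense orbit; a vector whose orbit is dense for uniform
    convergence on compact sets is built from x.

    Weak density is used twice. First, a continuous functional that vanishes on
    all T^j x with j >= n takes finitely many values on the orbit of x, hence is
    zero; by Hahn-Banach ([linear_separation]) the span of these vectors is
    dense ([orbit_comb_dense]). So every T^n has dense range, and H(U) has a
    countable dense subset, the rational combinations of the orbit
    ([target_recurrent]). Second, testing the orbit against finitely many point
    evaluations with a large constant as target shows that some iterate of phi
    sends a given finite set near the unit circle. As the iterates are uniformly
    Lipschitz on each disc |z| <= r, a whole disc goes near the circle
    ([escape_disc]). A map into U whose values on a disc are close to the circle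
    is nearly constant there ([nearly_constant]), so the disc |z| <= r is sent
    into a tiny neighbourhood of a point a of modulus nearly 1 ([run_away]).

    This makes T topologically transitive ([transitivity]). Given f and g, choose
    m as above and, by dense range, h with T^m h close to g. The polynomial
    (conj a * z)^N is small on the disc |z| <= r and close to 1 on its image, and
    0 and 1 are superattracting fixed points of s(z) = 3 z^2 - 2 z^3; hence
    iterates q of s applied to this polynomial tend to 0 on the disc and to 1 on
    the image, and F = q h + (1 - q) f is close to f while T^m F is close to g.

    A hypercyclic vector is the limit of a sequence F_k, where F_(k+1) is within
    2^-k of F_k on a disc and some iterate of T brings it within 2^-k of the k-th
    element of the countable dense set, each approximation being required on a
    disc large enough to preserve the preceding ones.

    The complex analysis involved reduces to one inequality, Cauchy's estimate
    |f'(z0)| <= 2 M / r ([cauchy_estimate]), for functions that are only assumed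
    to be complex differentiable at each point. It gives the Lipschitz bounds,
    near constancy (applied to powers of the map) and the holomorphy of locally
    uniform limits ([weierstrass]). It follows from Goursat's theorem on
    rectangles, pulled back by the exponential: with
    G(zeta) = (f(z0 + e^zeta) - f(z0)) e^-zeta, the mean of G over a vertical
    segment of length 2 pi does not depend on the segment, and it tends to
    f'(z0) as the real part goes to -oo. *)

(** * Integrals of continuous functions on segments *)

Section real_integrals.
Variable R : realType.
Implicit Types (f g : R -> R) (a b m : R).

(** Continuity is asked in a neighbourhood of each point of the segment, end
    points included, so that subsegments need no separate treatment. *)
Definition cont_on a b f := forall x, a <= x <= b -> {for x, continuous f}.

Definition segint a b f := Rintegral (@lebesgue_measure R) `[a, b] f.

Lemma cont_on_sub a b a' b' f : a <= a' -> b' <= b ->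
  cont_on a b f -> cont_on a' b' f.
Proof.
move=> aa' b'b cf x /andP[a'x xb']; apply: cf.
by rewrite (le_trans aa')// (le_trans xb').
Qed.

Lemma cont_onB a b f g : cont_on a b f -> cont_on a b g ->
  cont_on a b (fun x => f x - g x).
Proof. by move=> cf cg x xab; apply: continuousB; [exact: cf|exact: cg]. Qed.

Lemma cont_on_integrable a b f : cont_on a b f ->
  (@lebesgue_measure R).-integrable `[a, b] (EFin \o f).
Proof.
move=> cf; apply: continuous_compact_integrable; first exact: segment_compact.
apply: continuous_in_subspaceT => x; rewrite inE /= in_itv /=; exact: cf.
Qed.

Lemma segint_split a m b f : a <= m -> m <= b -> cont_on a b f ->
  segint a b f = segint a m f + segint m b f.
Proof.
move=> am mb cf; have := @Rintegral_itvB R f (BLeft a) (BRight b) m.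
rewrite /segint => /(_ (cont_on_integrable cf)).
rewrite !bnd_simp => /(_ am mb) e.
rewrite -(@Rintegral_itv_obnd_cbnd R m (BRight b)); last first.
  apply: integrableS (cont_on_integrable (cont_on_sub am (lexx b) cf)) => //.
  by apply: subset_itvr; rewrite bnd_simp.
by rewrite -e addrC subrK.
Qed.

Lemma segintB a b f g : cont_on a b f -> cont_on a b g ->
  segint a b (fun x => f x - g x) = segint a b f - segint a b g.
Proof. by move=> cf cg; apply: RintegralB => //; exact: cont_on_integrable. Qed.

Lemma segint_cst a b k : a <= b -> segint a b (fun=> k) = k * (b - a).
Proof.
move=> ab; rewrite /segint Rintegral_cst//=; congr (_ * _).
rewrite lebesgue_measure_itv /= lte_fin; case: ltP => //= ba.
by have -> : a = b by [apply/eqP; rewrite eq_le ab ba]; rewrite subrr.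
Qed.

(** The only way in which the value of an integral is ever estimated:
    comparison with a constant. *)
Lemma segint_approx a b k e f : a <= b -> cont_on a b f ->
  (forall x, a <= x <= b -> `|f x - k| <= e) ->
  `|segint a b f - k * (b - a)| <= e * (b - a).
Proof.
move=> ab cf fk.
have ck c : cont_on a b (fun=> c : R) by move=> x _; exact: cst_continuous.
rewrite -(segint_cst k ab) -segintB// -(segint_cst e ab).
apply: le_trans (le_normr_Rintegral _ _) _ => //.
  exact/cont_on_integrable/cont_onB.
apply: le_Rintegral => //.
- apply: (@cont_on_integrable _ _ (fun t => `|f t - k|)) => x xab.
  apply: (@continuous_comp _ _ _ (fun t => f t - k) Num.norm).
    exact: (cont_onB cf (ck k)).
  exact: norm_continuous.
- exact: cont_on_integrable.
Qed.

End real_integrals.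

(** * The real-valued modulus *)

Section complex_modulus.
Variable R : realType.
Implicit Types z w : R[i].

Lemma normr_normc z : `|z| = (normc z)%:C%C. Proof. by []. Qed.

Lemma normc_ge0 z : 0 <= normc z.
Proof. by rewrite -lecR -normr_normc normr_ge0. Qed.

Lemma normcD z w : normc (z + w) <= normc z + normc w.
Proof. exact: le_normcD. Qed.

Lemma normc_opp z : normc (- z) = normc z.
Proof. exact: normcN. Qed.

Lemma normc_sub z w : normc (z - w) = normc (w - z).
Proof. by rewrite -normc_opp opprB. Qed.

Lemma normcB z w : normc (z - w) <= normc z + normc w.
Proof. by rewrite -(normc_opp w); exact: normcD. Qed.

Lemma normc_triangle u z w : normc (z - w) <= normc (z - u) + normc (u - w).
Proof. by apply: le_trans (normcD _ _); rewrite addrA subrK. Qed.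

Lemma normc_eq0 z : (normc z == 0) = (z == 0).
Proof. by apply/eqP/eqP => [/eq0_normc//|->]; exact: normc0. Qed.

Lemma normc_gt0 z : (0 < normc z) = (z != 0).
Proof. by rewrite lt_neqAle normc_ge0 andbT eq_sym normc_eq0. Qed.

Lemma normcX z n : normc (z ^+ n) = normc z ^+ n.
Proof. by elim: n => [|n IH]; rewrite ?expr0 ?normc1// !exprS normcM IH. Qed.

Lemma normc_real (x : R) : normc x%:C%C = `|x|.
Proof. by rewrite /normc /= expr0n addr0 sqrtr_sqr. Qed.

Lemma normc_nat n : normc (n%:R : R[i]) = n%:R.
Proof. by rewrite -(rmorph_nat (real_complex R)) normc_real ger0_norm. Qed.

Lemma Re_le_normc z : `|complex.Re z| <= normc z.
Proof. by rewrite -lecR; exact: normc_ge_Re. Qed.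

Lemma Im_le_normc z : `|complex.Im z| <= normc z.
Proof.
case: z => x y /=; rewrite -(sqrtr_sqr y) ler_sqrt ?addr_ge0 ?sqr_ge0//.
by rewrite lerDr sqr_ge0.
Qed.

Lemma normc_le_ReIm z : normc z <= `|complex.Re z| + `|complex.Im z|.
Proof.
case: z => x y /=; rewrite -[leRHS]ger0_norm ?addr_ge0// -sqrtr_sqr.
rewrite ler_sqrt ?sqr_ge0// sqrrD !real_normK ?num_real//.
by rewrite addrAC lerDl mulrn_wge0// mulr_ge0.
Qed.

Lemma Re_sub z w : complex.Re (z - w) = complex.Re z - complex.Re w.
Proof. by case: z w => [? ?] [? ?]. Qed.

Lemma Im_sub z w : complex.Im (z - w) = complex.Im z - complex.Im w.
Proof. by case: z w => [? ?] [? ?]. Qed.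

Lemma expr_small (q e : R) : 0 <= q < 1 -> 0 < e ->
  exists N, forall n, (N <= n)%N -> q ^+ n < e.
Proof.
move=> /andP[q0 q1] e0.
have /cvgrPdist_lt /(_ e e0) [N _ NP] : q ^+ n @[n --> \oo] --> (0 : R).
  by apply: cvg_expr; rewrite ger0_norm.
exists N => n /NP /=; rewrite sub0r normrN ger0_norm ?exprn_ge0//.
Qed.

End complex_modulus.

(** * Goursat's theorem on rectangles *)

Section goursat.
Variable R : realType.
Local Notation C := R[i].
Local Notation Re := complex.Re.
Local Notation Im := complex.Im.
Implicit Types (G : C -> C) (a b c d : R) (z w : C).

(** Complex differentiability at z with derivative l, with real epsilons:
    positive elements of R[i] are awkward to compute with, as the order of
    R[i] is partial. *)
Definition cderiv G z (l : C) := forall e : R, 0 < e -> exists delta : R,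
  0 < delta /\ forall w, normc (w - z) < delta ->
    normc (G w - G z - l * (w - z)) <= e * normc (w - z).

Lemma cderiv_lip G z l : cderiv G z l -> exists delta : R,
  0 < delta /\ forall w, normc (w - z) < delta ->
    normc (G w - G z) <= (1 + normc l) * normc (w - z).
Proof.
move=> /(_ 1 ltr01)[d [d0 dP]]; exists d; split => // w /dP Hw.
rewrite -[G w - G z](subrK (l * (w - z))).
by rewrite (le_trans (normcD _ _))// normcM mulrDl lerD2r.
Qed.

(** The hypothesis on [h] covers horizontal and vertical lines, the only
    curves along which functions are integrated. *)
Lemma cderiv_slice_re G z l (h : R -> C) (t : R) : cderiv G z l -> h t = z ->
  (forall s, normc (h s - h t) = `|s - t|) ->
  {for t, continuous (fun s => Re (G (h s)))} /\
  {for t, continuous (fun s => Im (G (h s)))}.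
Proof.
move=> dG hz hd; have [e [e0 eP]] := cderiv_lip dG.
have key (p : C -> R) : (forall u v, p (u - v) = p u - p v) ->
    (forall u, `|p u| <= normc u) -> {for t, continuous (fun s => p (G (h s)))}.
  move=> pB pn; apply/cvgrPdist_lt => /= eps eps0.
  have nl : 0 < 1 + normc l by rewrite ltr_pwDl// normc_ge0.
  have epsl : (0 : R) < eps / (1 + normc l).
    apply: divr_gt0.
      exact: eps0.
    exact: nl.
  near=> s.
  rewrite distrC -pB (le_lt_trans (pn _))// hz.
  have st : `|s - t| < eps / (1 + normc l).
    rewrite distrC; near: s; apply: (@cvgr_dist_lt _ R^o); [exact: cvg_id|].
    exact: epsl.
  rewrite (le_lt_trans (eP _ _))// -hz hd; last by rewrite mulrC -ltr_pdivlMr.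
  by rewrite distrC; near: s; apply: (@cvgr_dist_lt _ R^o); [exact: cvg_id|].
by split; apply: key; [exact: Re_sub|exact: Re_le_normc|exact: Im_sub|
  exact: Im_le_normc].
Unshelve. all: by end_near. Qed.

Definition in_rect a b c d z := (a <= Re z <= b) && (c <= Im z <= d).

Definition rect_deriv G a b c d :=
  forall z, in_rect a b c d z -> exists l, cderiv G z l.

(** The circulation along the boundary of the rectangle of the real 1-form Im
    G ds + Re G dt = Re (- i G dz), where z = s + i t. Each pair of opposite
    sides is merged into one integral, so that only differences of G occur. *)
Definition rect_circ G a b c d :=
  segint c d (fun t => Re (G (b +i* t)%C) - Re (G (a +i* t)%C)) -
  segint a b (fun s => Im (G (s +i* d)%C) - Im (G (s +i* c)%C)).

Lemma cont_on_vert G a b c d x : rect_deriv G a b c d -> a <= x <= b ->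
  cont_on c d (fun t => Re (G (x +i* t)%C)).
Proof.
move=> dG xab t tcd; have [|l dl] := dG (x +i* t)%C; first exact/andP.
have [|] := @cderiv_slice_re G _ l (fun t => x +i* t)%C t dl erefl; last by [].
by move=> s; rewrite /= subrr expr0n add0r sqrtr_sqr.
Qed.

Lemma cont_on_hor G a b c d y : rect_deriv G a b c d -> c <= y <= d ->
  cont_on a b (fun s => Im (G (s +i* y)%C)).
Proof.
move=> dG ycd s sab; have [|l dl] := dG (s +i* y)%C; first exact/andP.
have [|] := @cderiv_slice_re G _ l (fun s => s +i* y)%C s dl erefl; last by [].
by move=> u; rewrite /= subrr expr0n addr0 sqrtr_sqr.
Qed.

(** Replacing G by its first order expansion at z changes both integrands by
    o(half-perimeter), and for the affine part both integrals are equal to Re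
    l times the area of the rectangle. This uses merged sides: the difference
    of an affine map across opposite sides is a constant. *)
Lemma rect_circ_local G z l : cderiv G z l -> forall e : R, 0 < e ->
  exists delta : R, 0 < delta /\ forall a b c d, a <= b -> c <= d ->
    rect_deriv G a b c d -> in_rect a b c d z ->
    (b - a) + (d - c) < delta ->
    `|rect_circ G a b c d| <= e * ((b - a) + (d - c)) ^+ 2.
Proof.
move=> dG e e0; have [|del [del0 delP]] := dG (e / 2); first exact: divr_gt0.
exists del; split=> // a b c d ab cd dR /andP[zab zcd] mdel.
set m := (b - a) + (d - c).
have near w : in_rect a b c d w -> normc (G w - G z - l * (w - z)) <= e / 2 * m.
  move=> /andP[wab wcd].
  have wm : normc (w - z) <= m.
    apply: le_trans (normc_le_ReIm _) _; rewrite Re_sub Im_sub.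
    by apply: lerD; rewrite ler_norml; apply/andP; split; lra.
  apply: le_trans (delP _ (le_lt_trans wm mdel)) _.
  by rewrite ler_wpM2l// divr_ge0// ltW.
have diff u v : in_rect a b c d u -> in_rect a b c d v ->
    normc (G u - G v - l * (u - v)) <= e * m.
  move=> /near Hu /near Hv.
  have -> : G u - G v - l * (u - v) =
    (G u - G z - l * (u - z)) - (G v - G z - l * (v - z)) by ring.
  by apply: le_trans (normcB _ _) _; lra.
have aab : a <= a <= b by rewrite lexx.
have bab : a <= b <= b by rewrite lexx andbT.
have ccd : c <= c <= d by rewrite lexx.
have dcd : c <= d <= d by rewrite lexx andbT.
have I1 : `|segint c d (fun t => Re (G (b +i* t)%C) - Re (G (a +i* t)%C)) -
    (Re l * (b - a)) * (d - c)| <= e * m * (d - c).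
  apply: segint_approx => //.
    by apply: cont_onB; [exact: (cont_on_vert dR bab)|exact: (cont_on_vert dR aab)].
  move=> t tcd; have := diff (b +i* t)%C (a +i* t)%C.
  rewrite /in_rect /= aab bab tcd => /(_ isT isT); apply: le_trans.
  apply: le_trans (Re_le_normc _); rewrite !Re_sub.
  by case: (l) => l1 l2 /=; rewrite subrr mulr0 subr0.
have I2 : `|segint a b (fun s => Im (G (s +i* d)%C) - Im (G (s +i* c)%C)) -
    (Re l * (d - c)) * (b - a)| <= e * m * (b - a).
  apply: segint_approx => //.
    by apply: cont_onB; [exact: (cont_on_hor dR dcd)|exact: (cont_on_hor dR ccd)].
  move=> t tab; have := diff (t +i* d)%C (t +i* c)%C.
  rewrite /in_rect /= ccd dcd tab => /(_ isT isT); apply: le_trans.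
  apply: le_trans (Im_le_normc _); rewrite !Im_sub.
  by case: (l) => l1 l2 /=; rewrite subrr mulr0 addr0.
rewrite /rect_circ.
move: I1 I2; set X := segint c d _; set Y := segint a b _ => I1 I2.
have -> : X - Y = (X - Re l * (b - a) * (d - c)) - (Y - Re l * (d - c) * (b - a)).
  by ring.
apply: le_trans (ler_normB _ _) _.
apply: le_trans (lerD I1 I2) _.
by rewrite -mulrDr -mulrA /m [(d - c) + _]addrC expr2.
Qed.

Lemma rect_deriv_sub G a b c d a' b' c' d' : a <= a' -> b' <= b -> c <= c' ->
  d' <= d -> rect_deriv G a b c d -> rect_deriv G a' b' c' d'.
Proof.
move=> ? ? ? ? dG z /andP[/andP[? ?] /andP[? ?]]; apply: dG.
by apply/andP; split; apply/andP; split; lra.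
Qed.

Lemma rect_circ_splitx G a x b c d : a <= x <= b -> c <= d ->
  rect_deriv G a b c d ->
  rect_circ G a b c d = rect_circ G a x c d + rect_circ G x b c d.
Proof.
move=> /andP[ax xb] cd dG; rewrite /rect_circ.
have ab := le_trans ax xb.
have cv y : a <= y <= b -> cont_on c d (fun t => Re (G (y +i* t)%C)).
  exact: cont_on_vert.
have ch y : c <= y <= d -> cont_on a b (fun s => Im (G (s +i* y)%C)).
  exact: cont_on_hor.
rewrite (@segint_split _ a x b)//; last first.
  by apply: cont_onB; apply: ch; rewrite ?lexx ?cd.
rewrite !(@segintB _ c d); try (by apply: cv; rewrite ?lexx ?ab ?ax ?xb).
by ring.
Qed.

Lemma rect_circ_splity G a b c y d : a <= b -> c <= y <= d ->
  rect_deriv G a b c d ->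
  rect_circ G a b c d = rect_circ G a b c y + rect_circ G a b y d.
Proof.
move=> ab /andP[cy yd] dG; rewrite /rect_circ.
have cd := le_trans cy yd.
have cv x : a <= x <= b -> cont_on c d (fun t => Re (G (x +i* t)%C)).
  exact: cont_on_vert.
have ch t : c <= t <= d -> cont_on a b (fun s => Im (G (s +i* t)%C)).
  exact: cont_on_hor.
rewrite (@segint_split _ c y d)//; last first.
  by apply: cont_onB; apply: cv; rewrite ?lexx ?ab.
rewrite !(@segintB _ a b); try (by apply: ch; rewrite ?lexx ?cd ?cy ?yd).
by ring.
Qed.

End goursat.

Section goursat_theorem.
Variable R : realType.
Local Notation C := R[i].
Local Notation Re := complex.Re.
Local Notation Im := complex.Im.

Record rect := Rect { rect_left : R; rect_right : R; rect_bottom : R; rect_top : R }.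
Implicit Types Q : rect.

Definition half_perim Q := (rect_right Q - rect_left Q) + (rect_top Q - rect_bottom Q).

Definition subrect Q' Q := [/\ rect_left Q <= rect_left Q', rect_right Q' <= rect_right Q, rect_bottom Q <= rect_bottom Q' &
  rect_top Q' <= rect_top Q].

Variables (G : C -> C) (Q0 : rect).
Hypothesis dG : rect_deriv G (rect_left Q0) (rect_right Q0) (rect_bottom Q0) (rect_top Q0).
Variable e : R.

(** Rectangles on which the circulation is too large compared with the square
    of the half-perimeter; this square, unlike the area, is adapted to
    rectangles of any shape, and the sum of its values over the four quarters
    is its value on the whole. *)
Definition bad Q := [/\ subrect Q Q0,
  rect_left Q <= rect_right Q, rect_bottom Q <= rect_top Q &
  e * half_perim Q ^+ 2 <
    `|rect_circ G (rect_left Q) (rect_right Q) (rect_bottom Q) (rect_top Q)|].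

(** The circulation is the sum of those over the four quarters, and each half-
    perimeter is halved; were all quarters good, the whole would be. *)
Lemma bad_quarter Q : bad Q ->
  exists Q', [/\ bad Q', subrect Q' Q & half_perim Q' = half_perim Q / 2].
Proof.
case: Q => a b c d; rewrite /bad /subrect /half_perim /=.
move=> [] [ha hb hc hd] ab cd lt.
set x := (a + b) / 2; set y := (c + d) / 2.
have dQ := rect_deriv_sub ha hb hc hd dG.
have [ax xb] : a <= x /\ x <= b by rewrite /x; split; lra.
have [cy yd] : c <= y /\ y <= d by rewrite /y; split; lra.
have dL : rect_deriv G a x c d := rect_deriv_sub (lexx a) xb (lexx c) (lexx d) dQ.
have dR : rect_deriv G x b c d := rect_deriv_sub ax (lexx b) (lexx c) (lexx d) dQ.
move: lt; rewrite (@rect_circ_splitx _ G a x b) ?ax//.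
rewrite (@rect_circ_splity _ G a x c y d) ?cy//.
rewrite (@rect_circ_splity _ G x b c y d) ?cy//.
set m := (b - a) + (d - c).
have pick a' b' c' d' : a <= a' -> a' <= b' -> b' <= b -> c <= c' -> c' <= d' ->
    d' <= d -> (b' - a') + (d' - c') = m / 2 ->
    (exists Q', [/\ [/\ [/\ rect_left Q0 <= rect_left Q', rect_right Q' <= rect_right Q0, rect_bottom Q0 <= rect_bottom Q' &
      rect_top Q' <= rect_top Q0], rect_left Q' <= rect_right Q', rect_bottom Q' <= rect_top Q' &
      e * (rect_right Q' - rect_left Q' + (rect_top Q' - rect_bottom Q')) ^+ 2
       < `|rect_circ G (rect_left Q') (rect_right Q') (rect_bottom Q') (rect_top Q')|],
      [/\ a <= rect_left Q', rect_right Q' <= b, c <= rect_bottom Q' & rect_top Q' <= d] &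
      (rect_right Q' - rect_left Q') + (rect_top Q' - rect_bottom Q') = m / 2]) \/
    `|rect_circ G a' b' c' d'| <= e * (m / 2) ^+ 2.
  move=> *; case: leP => [le|lt']; [by right|left].
  exists (Rect a' b' c' d') => /=; split => //; last first.
  split => //; last by rewrite (_ : b' - a' + (d' - c') = m / 2).
  by split; lra.
have [//|L1] := pick a x c y (lexx _) ax xb (lexx _) cy yd
  ltac:(rewrite /m /x /y; lra).
have [//|L2] := pick a x y d (lexx _) ax xb cy yd (lexx _)
  ltac:(rewrite /m /x /y; lra).
have [//|L3] := pick x b c y ax xb (lexx _) (lexx _) cy yd
  ltac:(rewrite /m /x /y; lra).
have [//|L4] := pick x b y d ax xb (lexx _) cy yd (lexx _)
  ltac:(rewrite /m /x /y; lra).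
rewrite ltNge => /negP[].
apply: le_trans (ler_normD _ _) _.
have le4 := lerD (le_trans (ler_normD _ _) (lerD L1 L2))
                 (le_trans (ler_normD _ _) (lerD L3 L4)).
by apply: le_trans le4 _; rewrite expr_div_n; lra.
Qed.

Hypothesis e0 : 0 < e.

(** Repeated quartering leads to a nested sequence of bad rectangles shrinking
    to a point, which contradicts [rect_circ_local] at that point. *)
Lemma not_bad Q : ~ bad Q.
Proof.
move=> badQ.
pose T := {Q | bad Q}.
have step (q : T) : {q' : T | subrect (sval q') (sval q) /\
    half_perim (sval q') = half_perim (sval q) / 2}.
  apply: cid; have [Q' [bQ' s h]] := bad_quarter (svalP q).
  by exists (exist _ Q' bQ').
have [q [q0 qS]] := dependent_choice step (exist _ Q badQ).
pose r n := sval (q n).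
have bad_r n : bad (r n) := svalP (q n).
have subr n k : subrect (r (n + k)%N) (r n).
  elim: k => [|k [h1 h2 h3 h4]]; first by rewrite addn0; split.
  rewrite addnS; have [[g1 g2 g3 g4] _] := qS (n + k)%N.
  by split; [exact: le_trans g1|exact: le_trans h2|exact: le_trans g3|
             exact: le_trans h4].
have lr n m : rect_left (r n) <= rect_right (r m) /\ rect_bottom (r n) <= rect_top (r m).
  have [_ h1 h2 _] := bad_r (n + m)%N.
  have [g1 _ g3 _] := subr n m; have := subr m n; rewrite addnC => -[_ g2 _ g4].
  by split; [exact: le_trans (le_trans g1 h1) g2|exact: le_trans (le_trans g3 h2) g4].
have mid (l u : nat -> R) : (forall n m, l n <= u m) ->
    exists x, forall n, l n <= x <= u n.
  move=> lu; exists (sup (range l)) => n; apply/andP; split.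
    by apply: ub_le_sup; [exists (u 0%N) => _ [k _ <-]|exists n].
  by apply: ge_sup; [exists (l 0%N), 0%N|move=> _ [k _ <-]].
have [x xP] := mid (rect_left \o r) (rect_right \o r) (fun n m => proj1 (lr n m)).
have [y yP] := mid (rect_bottom \o r) (rect_top \o r) (fun n m => proj2 (lr n m)).
have zP n : in_rect (rect_left (r n)) (rect_right (r n)) (rect_bottom (r n)) (rect_top (r n)) (x +i* y)%C.
  by apply/andP; split; [exact: xP|exact: yP].
have [s1 s2 s3 s4] : subrect (r 0%N) Q0 by have [] := bad_r 0%N.
have [l dl] := rect_deriv_sub s1 s2 s3 s4 dG (zP 0%N).
have [delta [delta0 deltaP]] := rect_circ_local dl e0.
have hm n : half_perim (r n) = half_perim (r 0%N) * 2^-1 ^+ n.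
  elim: n => [|n IH]; first by rewrite expr0 mulr1.
  by have [_ ->] := qS n; rewrite -/(r n) IH exprSr mulrA.
have hm0 : 0 <= half_perim (r 0%N).
  by have [_ ? ? _] := bad_r 0%N; rewrite /half_perim addr_ge0 ?subr_ge0.
have [n nP] : exists n, half_perim (r n) < delta.
  have [||n /(_ n (leqnn n)) nP] := @expr_small R 2^-1
      (delta / (1 + half_perim (r 0%N))).
  - by apply/andP; split; lra.
  - by rewrite divr_gt0// ltr_pwDl.
  exists n; rewrite hm; move: nP; rewrite ltr_pdivlMr ?ltr_pwDl// => nP.
  apply: le_lt_trans nP; rewrite mulrC ler_wpM2l ?exprn_ge0// ?lerDr//.
have [[t1 t2 t3 t4] h1 h2] := bad_r n.
have := deltaP _ _ _ _ h1 h2 (rect_deriv_sub t1 t2 t3 t4 dG) (zP n) nP.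
by rewrite leNgt => /negP.
Qed.

End goursat_theorem.

Theorem goursat (R : realType) (G : R[i] -> R[i]) (a b c d : R) :
  a <= b -> c <= d -> rect_deriv G a b c d -> rect_circ G a b c d = 0.
Proof.
move=> ab cd dG; apply/normr0_eq0/eqP; rewrite eq_le normr_ge0 andbT.
apply/ler_addgt0Pr => e e0; rewrite add0r.
set m := (b - a) + (d - c).
have m0 : 0 <= m by rewrite addr_ge0// subr_ge0.
have m1 : 0 < 1 + m ^+ 2 by rewrite ltr_pwDl// sqr_ge0.
have := @not_bad R G (Rect a b c d) dG (e / (1 + m ^+ 2)) (divr_gt0 e0 m1)
  (Rect a b c d).
apply: contra_notP => /negP; rewrite -ltNge => lt; split => //=.
apply: le_lt_trans lt; rewrite /half_perim /= -/m.
by rewrite mulrAC ler_pdivrMr// ler_wpM2l ?(ltW e0)// lerDr.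
Qed.

(** * Complex derivatives and the exponential *)

Section derivative_eps.
Variable K : numFieldType.

(** Stated over any numFieldType since it is used both for the real functions
    exp, cos, sin and for complex functions. *)
Lemma is_derive_epsP (f : K^o -> K^o) (x l : K^o) :
  is_derive x (1 : K^o) f l <->
  forall e : K, 0 < e -> exists2 d : K, 0 < d &
    forall y, `|y - x| < d -> `|f y - f x - l * (y - x)| <= e * `|y - x|.
Proof.
have quot (h : K) : h != 0 ->
    `|l - h^-1 * (f (h * 1 + x) - f x)| =
    `|f (h + x) - f x - l * h| / `|h|.
  move=> h0; rewrite mulr1 -normfV -normrM -normrN; congr (`| _ |); by field.
split=> [df e e0|H].
- have [dx dl] := df.
  have : (h^-1 *: ((f \o shift x) (h *: (1 : K^o)) - f x)) @[h --> 0^'] --> l.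
    by rewrite -dl; exact: dx.
  move=> /cvgrPdist_le /(_ e e0) /nbhs_ballP [d /= d0 dP]; exists d => // y yx.
  have [->|yx0] := eqVneq y x; first by rewrite !subrr mulr0 subrr normr0 mulr0.
  have h0 : y - x != 0 by rewrite subr_eq0.
  have := dP (y - x); rewrite /ball /= sub0r normrN => /(_ yx h0).
  by rewrite quot// subrK ler_pdivrMr ?normr_gt0.
- have cv : (h^-1 *: ((f \o shift x) (h *: (1 : K^o)) - f x)) @[h --> 0^'] --> l.
    apply/cvgrPdist_le => e e0; have [d d0 dP] := H _ e0.
    apply/nbhs_ballP; exists d => //= h; rewrite /ball /= sub0r normrN => hd h0.
    have := dP (h + x); rewrite addrK => /(_ hd) le.
    rewrite -[leLHS]/(`|l - h^-1 * (f (h * 1 + x) - f x)|) quot//.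
    by rewrite ler_pdivrMr ?normr_gt0.
  apply: DeriveDef; first by apply/cvg_ex; exists l.
  exact: (cvg_lim (@norm_hausdorff _ _) cv).
Qed.

End derivative_eps.

Section complex_derivative.
Variable R : realType.
Local Notation C := R[i].
Local Notation Re := complex.Re.
Local Notation Im := complex.Im.
Implicit Types (f g : C -> C) (z w : C).

Lemma cderivP f z l : cderiv f z l <-> is_derive (z : C^o) (1 : C^o) (f : C^o -> C^o) l.
Proof.
rewrite is_derive_epsP; split=> [H e e0|H e e0].
- have eR : e = (Re e)%:C%C by rewrite RRe_real// gtr0_real.
  move: (e0); rewrite eR ltcR => /H[d [d0 dP]]; exists d%:C%C; first by rewrite ltcR.
  move=> y; rewrite !normr_normc ltcR => /dP le.
  by rewrite -rmorphM lecR.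
- have [|d d0 dP] := H e%:C%C; first by rewrite ltcR.
  have dR : d = (Re d)%:C%C by rewrite RRe_real// gtr0_real.
  exists (Re d); split; first by move: d0; rewrite dR ltcR.
  move=> w wz; have := dP w; rewrite !normr_normc dR ltcR -rmorphM lecR.
  exact.
Qed.

Lemma derivable_cderiv f z :
  derivable (f : C^o -> C^o) (z : C^o) (1 : C^o) <-> exists l, cderiv f z l.
Proof.
split=> [/derivableP df|[l /cderivP[]]//].
by exists ('D_(1 : C^o) (f : C^o -> C^o) (z : C^o)); apply/cderivP.
Qed.

Lemma cderiv_cst (k : C) z : cderiv (fun=> k) z 0.
Proof.
move=> e e0; exists 1; split=> // w _.
by rewrite subrr mul0r subr0 normc0 mulr_ge0 ?normc_ge0// ltW.
Qed.

Lemma cderiv_id z : cderiv (fun w => w) z 1.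
Proof.
move=> e e0; exists 1; split=> // w _.
by rewrite mul1r subrr normc0 mulr_ge0 ?normc_ge0// ltW.
Qed.

Lemma cderivD f g z a b : cderiv f z a -> cderiv g z b ->
  cderiv (fun w => f w + g w) z (a + b).
Proof. by move=> /cderivP ? /cderivP ?; apply/cderivP; exact: is_deriveD. Qed.

Lemma cderivM f g z a b : cderiv f z a -> cderiv g z b ->
  cderiv (fun w => f w * g w) z (f z * b + g z * a).
Proof. by move=> /cderivP ? /cderivP ?; apply/cderivP; exact: is_deriveM. Qed.

Lemma cderivZ f z k a : cderiv f z a -> cderiv (fun w => k * f w) z (k * a).
Proof.
move=> df; have := cderivM (cderiv_cst k z) df.
by rewrite mulr0 addr0.
Qed.

Lemma cderivB f g z a b : cderiv f z a -> cderiv g z b ->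
  cderiv (fun w => f w - g w) z (a - b).
Proof. by move=> /cderivP ? /cderivP ?; apply/cderivP; exact: is_deriveB. Qed.

Lemma cderiv_comp f g z a b : cderiv f (g z) a -> cderiv g z b ->
  cderiv (fun w => f (g w)) z (a * b).
Proof.
move=> df dg e e0.
have a1 : 0 < 1 + normc a by rewrite ltr_pwDl// normc_ge0.
have b1 : 0 < 1 + normc b by rewrite ltr_pwDl// normc_ge0.
have [|d1 [d10 d1P]] := df (e / 2 / (1 + normc b)); first by rewrite !divr_gt0.
have [|d2 [d20 d2P]] := dg (e / 2 / (1 + normc a)); first by rewrite !divr_gt0.
have [d3 [d30 d3P]] := cderiv_lip dg.
exists (Num.min (Num.min d2 d3) (d1 / (1 + normc b))); split.
  by rewrite !lt_min d20 d30 divr_gt0.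
move=> w; rewrite !lt_min => /andP[/andP[w2 w3] w1].
have gw := d3P w w3.
have {}/d1P H1 : normc (g w - g z) < d1.
  by apply: le_lt_trans gw _; rewrite mulrC -ltr_pdivlMr.
have H2 := d2P w w2.
have -> : f (g w) - f (g z) - a * b * (w - z) =
  (f (g w) - f (g z) - a * (g w - g z)) + a * (g w - g z - b * (w - z)) by ring.
apply: le_trans (normcD _ _) _; rewrite normcM.
have L1 : normc (f (g w) - f (g z) - a * (g w - g z)) <= e / 2 * normc (w - z).
  apply: le_trans H1 _; apply: le_trans (ler_wpM2l _ gw) _.
    by rewrite !divr_ge0// ltW.
  by rewrite mulrA divfK// gt_eqF.
have L2 : normc a * normc (g w - g z - b * (w - z)) <= e / 2 * normc (w - z).
  apply: le_trans (ler_wpM2l (normc_ge0 a) H2) _.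
  rewrite mulrA ler_wpM2r ?normc_ge0// mulrA ler_pdivrMr// mulrC.
  by rewrite ler_wpM2l ?divr_ge0 ?(ltW e0)// lerDr.
by lra.
Qed.

Lemma cderivX f z a n : cderiv f z a ->
  cderiv (fun w => f w ^+ n) z (n%:R * f z ^+ n.-1 * a).
Proof.
move=> df; elim: n => [|n IH].
  by rewrite !mul0r; have := cderiv_cst 1 z; congr cderiv; apply/funext => w; rewrite expr0.
have -> : (fun w => f w ^+ n.+1) = (fun w => f w * f w ^+ n).
  by apply/funext => w; rewrite exprS.
have -> : n.+1%:R * f z ^+ n.+1.-1 * a =
    f z * (n%:R * f z ^+ n.-1 * a) + f z ^+ n * a.
  case: n {IH} => [|n] /=; first by rewrite !mul0r mulr0 add0r mul1r.
  by rewrite -[n.+2%:R]natr1 exprS; ring.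
exact: cderivM.
Qed.

(** Differentiability depends on the germ only: needed since functions on the
    disk are extended by 0 outside of it. *)
Lemma cderiv_near f g z a r : 0 < r ->
  (forall w, normc (w - z) < r -> f w = g w) -> cderiv f z a -> cderiv g z a.
Proof.
move=> r0 fg df e /df[d [d0 dP]]; exists (Num.min d r); split.
  by rewrite lt_min d0.
move=> w; rewrite lt_min => /andP[/dP + wr].
by rewrite !fg// subrr normc0.
Qed.

Definition cexp z : C := (expR (Re z) * cos (Im z) +i* (expR (Re z) * sin (Im z)))%C.

Lemma cexpD z w : cexp (z + w) = cexp z * cexp w.
Proof.
case: z w => [a b] [c d]; rewrite /cexp /= expRD cosD sinD.
by apply/eqP; rewrite eq_complex /=; apply/andP; split; apply/eqP; ring.
Qed.

Lemma cexp0 : cexp 0 = 1.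
Proof. by rewrite /cexp /= expR0 cos0 sin0 mulr1 mulr0. Qed.

Lemma normc_cexp z : normc (cexp z) = expR (Re z).
Proof.
rewrite /cexp /normc !exprMn -mulrDr cos2Dsin2 mulr1 sqrtr_sqr ger0_norm//.
Qed.

Lemma cexpNK z : cexp z * cexp (- z) = 1.
Proof. by rewrite -cexpD subrr cexp0. Qed.

Lemma cexp_period (s : R) : cexp (s +i* (pi *+ 2))%C = cexp (s +i* 0)%C.
Proof. by rewrite /cexp /= cos2pi sin2pi cos0 sin0. Qed.

(** With p, q, r the remainders of exp x, cos y, sin y at first order, the
    real and imaginary parts of exp h - 1 - h are p + q (1 + x + p) and r (1 +
    x + p) + y (x + p). *)
Lemma cexp_approx0 (e : R) : 0 < e -> exists d, 0 < d /\
  forall h, normc h < d -> normc (cexp h - 1 - h) <= e * normc h.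
Proof.
move=> e0.
have [k [k0 k1 ke]] : exists k : R, [/\ 0 < k, k <= 1 & 9 * k <= e].
  exists (Num.min 1 (e / 9)); split.
  - by rewrite lt_min ltr01 divr_gt0.
  - by rewrite ge_min lexx.
  - by rewrite mulrC -ler_pdivlMr// ge_min lexx orbT.
have [d1 d10 d1P] := (is_derive_epsP _ _ _).1 (is_derive_expR (0 : R)) k k0.
have [d2 d20 d2P] := (is_derive_epsP _ _ _).1 (is_derive_cos (0 : R)) k k0.
have [d3 d30 d3P] := (is_derive_epsP _ _ _).1 (is_derive_sin (0 : R)) k k0.
exists (Num.min (Num.min d1 d2) (Num.min d3 k)); split.
  by rewrite !lt_min d10 d20 d30 k0.
move=> h; rewrite !lt_min => /andP[/andP[hd1 hd2] /andP[hd3 hk]].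
have hx := Re_le_normc h; have hy := Im_le_normc h.
have -> : cexp h - 1 - h = ((expR (Re h) * cos (Im h) - 1 - Re h) +i*
    (expR (Re h) * sin (Im h) - Im h))%C.
  by case: (h) => x y; apply/eqP; rewrite eq_complex /= ?subr0 ?addr0 !eqxx.
have n0 := normc_ge0 h.
move: hd1 hd2 hd3 hk hx hy n0.
set n := normc h; set x := Re h; set y := Im h.
move=> hd1 hd2 hd3 hk hx hy n0.
have := d1P x; rewrite subr0 expR0 mul1r => /(_ (le_lt_trans hx hd1)) E1.
have := d2P y; rewrite subr0 cos0 sin0 oppr0 mul0r subr0 => /(_ (le_lt_trans hy hd2)) E2.
have := d3P y; rewrite subr0 cos0 sin0 subr0 mul1r => /(_ (le_lt_trans hy hd3)) E3.
apply: le_trans (normc_le_ReIm _) _ => /=.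
move: E1 E2 E3; set p := expR x - 1 - x; set q := cos y - 1; set r := sin y - y.
move=> E1 E2 E3.
have E4 : `|1 + x + p| <= 3.
  apply: le_trans (ler_normD _ _) _; apply: le_trans (lerD (ler_normD _ _) E1) _.
  rewrite normr1.
  have : k * `|x| <= 1 * 1 by apply: ler_pM => //; [exact: ltW|lra].
  by lra.
have E5 : k * `|x| <= k * n by rewrite ler_wpM2l// ltW.
have E6 : k * `|y| <= k * n by rewrite ler_wpM2l// ltW.
have -> : expR x * cos y - 1 - x = p + q * (1 + x + p) by rewrite /p /q; ring.
have -> : expR x * sin y - y = r * (1 + x + p) + y * (x + p).
  by rewrite /p /r; ring.
have F1 : `|q * (1 + x + p)| <= k * n * 3.
  by rewrite normrM; apply: ler_pM => //; lra.
have F2 : `|r * (1 + x + p)| <= k * n * 3.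
  by rewrite normrM; apply: ler_pM => //; lra.
have F3 : `|y * (x + p)| <= n * (2 * k).
  rewrite normrM; apply: ler_pM => //; apply: le_trans (ler_normD _ _) _.
  have : k * `|x| <= k * 1 by rewrite ler_wpM2l// ?ltW//; lra.
  by lra.
have := ler_normD p (q * (1 + x + p)).
have := ler_normD (r * (1 + x + p)) (y * (x + p)).
have : 9 * k * n <= e * n by rewrite ler_wpM2r.
by lra.
Qed.

Lemma cderiv_cexp z : cderiv cexp z (cexp z).
Proof.
move=> e e0.
have ez : 0 < normc (cexp z) by rewrite normc_cexp expR_gt0.
have [d [d0 dP]] := cexp_approx0 (divr_gt0 e0 ez).
exists d; split=> // w /dP; set h := w - z => le.
have -> : cexp w - cexp z - cexp z * h = cexp z * (cexp h - 1 - h).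
  by rewrite -[w](subrK z) -/h addrC cexpD; ring.
by rewrite normcM mulrC -ler_pdivlMr// mulrAC.
Qed.


End complex_derivative.

(** * Cauchy's estimate and the mean value inequality *)

Section cauchy_estimate.
Variable R : realType.
Local Notation C := R[i].
Local Notation Re := complex.Re.
Local Notation Im := complex.Im.
Implicit Types (f g : C -> C) (z w l : C).

Lemma cderivN z : cderiv (fun w => - w) z (-1).
Proof.
have := cderivB (cderiv_cst 0 z) (cderiv_id z).
by rewrite sub0r; congr cderiv; apply/funext => w; rewrite sub0r.
Qed.

(** Closed ball, since the estimate integrates over the circle of radius r
    itself. *)
Definition deriv_in_ball f z0 (r : R) :=
  forall z, normc (z - z0) <= r -> exists l, cderiv f z l.

(** Goursat's theorem for G(zeta) = (f(z0 + e^zeta) - f(z0)) e^-zeta on the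
    rectangle a <= Re zeta <= b, 0 <= Im zeta <= 2 pi: the two horizontal
    sides cancel by periodicity, so the integrals of Re G over the vertical
    sides agree. The one with e^a small is close to 2 pi Re f'(z0), the one
    with e^b = r is at most 2 pi times the maximum of |G|. *)
Lemma re_cauchy_estimate f z0 l (r M : R) : 0 < r -> deriv_in_ball f z0 r ->
  (forall z, normc (z - z0) <= r -> normc (f z) <= M) -> cderiv f z0 l ->
  `|Re l| <= 2 * M / r.
Proof.
move=> r0 df fM dl; apply/ler_addgt0Pr => e e0.
pose G z := (f (z0 + cexp z) - f z0) * cexp (- z).
have Gdiv z : G z = (f (z0 + cexp z) - f z0) / cexp z.
  congr (_ * _); apply: (@mulfI _ (cexp z)); rewrite ?cexpNK ?divff//.
    by rewrite -normc_gt0 normc_cexp expR_gt0.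
  by rewrite -normc_gt0 normc_cexp expR_gt0.
have [d [d0 dP]] := dl e e0.
have [a [b [ab ead eb]]] : exists a b : R, [/\ a <= b, expR a < d & expR b = r].
  exists (Num.min (ln (d / 2)) (ln r)), (ln r); split; last by rewrite lnK.
    by rewrite ge_min lexx orbT.
  apply: (@le_lt_trans _ _ (d / 2)); last by lra.
  by rewrite -[leRHS]lnK ?posrE ?divr_gt0// ler_expR ge_min lexx.
(* the period 2 pi is made abstract to keep the arithmetic light *)
have [P [p0 per]] : exists P : R, 0 < P /\
    forall s, cexp (s +i* P)%C = cexp (s +i* 0)%C.
  exists (pi *+ 2); split; first by rewrite mulrn_wgt0// pi_gt0.
  exact: cexp_period.
have pi2 := ltW p0.
have dG : rect_deriv G a b 0 P.
  move=> z /andP[/andP[_ zb] _].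
  have [|k dk] := df (z0 + cexp z); first by rewrite addrAC subrr add0r normc_cexp -eb ler_expR.
  have d1 := cderivD (cderiv_cst z0 z) (cderiv_cexp z).
  have d2 := cderivB (cderiv_comp (g := fun w => z0 + cexp w) dk d1) (cderiv_cst (f z0) z).
  have d3 := cderiv_comp (g := fun w => - w) (cderiv_cexp (- z)) (cderivN z).
  by eexists; exact: (cderivM d2 d3).
have ca : cont_on 0 P (fun t => Re (G (a +i* t)%C)).
  by apply: (cont_on_vert dG); rewrite lexx.
have cb : cont_on 0 P (fun t => Re (G (b +i* t)%C)).
  by apply: (cont_on_vert dG); rewrite lexx ab.
have Ia : `|segint 0 P (fun t => Re (G (a +i* t)%C)) - Re l * (P - 0)|
    <= e * (P - 0).
  apply: segint_approx => // t _; rewrite -Re_sub.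
  apply: le_trans (Re_le_normc _) _; rewrite Gdiv.
  set h := cexp _; have nh : normc h = expR a by rewrite normc_cexp.
  have h0 : h != 0 by rewrite -normc_gt0 nh expR_gt0.
  have := dP (z0 + h); rewrite addrAC subrr add0r nh => /(_ ead).
  have -> : f (z0 + h) - f z0 - l * h = ((f (z0 + h) - f z0) / h - l) * h.
    by rewrite mulrBl divfK.
  by rewrite normcM nh ler_pM2r ?expR_gt0.
have Ib : `|segint 0 P (fun t => Re (G (b +i* t)%C)) - 0 * (P - 0)|
    <= 2 * M / r * (P - 0).
  apply: segint_approx => // t _; rewrite subr0.
  apply: le_trans (Re_le_normc _) _; rewrite Gdiv.
  set h := cexp _; have nh : normc h = r by rewrite normc_cexp.
  rewrite normcM normcV nh ler_pM2r ?invr_gt0//.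
  apply: le_trans (normcB _ _) _.
  have := fM (z0 + h); rewrite addrAC subrr add0r nh lexx => /(_ isT).
  have := fM z0; rewrite subrr normc0 ltW// => /(_ isT).
  by lra.
have := goursat ab pi2 dG; rewrite /rect_circ.
have -> : segint a b (fun s => Im (G (s +i* P)%C) - Im (G (s +i* 0)%C)) = 0.
  rewrite (_ : (fun s => _) = fun=> 0); last first.
    by apply/funext => s; rewrite !Gdiv per subrr.
  by rewrite segint_cst// mul0r.
rewrite subr0.
rewrite segintB// => /eqP; rewrite subr_eq0 => /eqP Eab.
move: Ia Ib; rewrite Eab !subr0 mul0r subr0 {Eab}; set X := segint _ _ _ => Ia Ib.
rewrite -(ler_pM2r p0) mulrDl -[X in `|_| * X]gtr0_norm// -normrM.
rewrite -[Re l * _](subKr X) distrC.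
apply: le_trans (ler_normD _ _) _.
by rewrite addrC normrN lerD// distrC.
Qed.

(** Multiplying f by the conjugate of f'(z0) makes the derivative real, which
    reduces the bound to that of its real part. *)
Lemma cauchy_estimate f z0 l (r M : R) : 0 < r -> deriv_in_ball f z0 r ->
  (forall z, normc (z - z0) <= r -> normc (f z) <= M) -> cderiv f z0 l ->
  normc l <= 2 * M / r.
Proof.
move=> r0 df fM dl.
have [l0|l0] := eqVneq l 0.
  rewrite l0 normc0 divr_ge0 ?(ltW r0)// pmulr_rge0//.
  by have := fM z0; rewrite subrr normc0 ltW// => /(_ isT); apply: le_trans (normc_ge0 _).
have nl : 0 < normc l by rewrite normc_gt0.
have nconj : normc (conjc l) = normc l by case: (l) => x y; rewrite /normc /= sqrrN.
have := @re_cauchy_estimate (fun z => conjc l * f z) z0 (conjc l * l) r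
  (normc l * M) r0.
have -> : `|Re (conjc l * l)| = normc l * normc l.
  rewrite -expr2; have := @sqr_normc _ l; rewrite mulrC normr_normc -rmorphXn => <-.
  by rewrite /= ger0_norm ?exprn_ge0 ?normc_ge0.
have -> : 2 * (normc l * M) / r = normc l * (2 * M / r) by ring.
rewrite ler_pM2l//; apply.
- by move=> z /df[k dk]; exists (conjc l * k); exact: cderivZ.
- by move=> z /fM; rewrite normcM nconj ler_pM2l.
- exact: cderivZ.
Qed.

(** Restriction to a segment, to which the real mean value theorem applies. *)
Lemma cderiv_line_re f z w l (t : R) :
  cderiv f (z + t%:C%C * (w - z)) l ->
  is_derive t 1 (fun s : R => Re (f (z + s%:C%C * (w - z)))) (Re (l * (w - z))).
Proof.
move=> dl; apply/is_derive_epsP => e e0.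
have n1 : 0 < 1 + normc (w - z) by rewrite ltr_pwDl// normc_ge0.
have [d [d0 dP]] := dl _ (divr_gt0 e0 n1).
exists (d / (1 + normc (w - z))); first by rewrite divr_gt0.
move=> s st; set v := w - z.
have us : (z + s%:C%C * v) - (z + t%:C%C * v) = (s - t)%:C%C * v.
  by rewrite rmorphB; ring.
have nus : normc ((z + s%:C%C * v) - (z + t%:C%C * v)) = `|s - t| * normc v.
  by rewrite us normcM normc_real.
have := dP (z + s%:C%C * v); rewrite nus us => /(_ _) le.
have {}le : normc (f (z + s%:C%C * v) - f (z + t%:C%C * v) -
     l * ((s - t)%:C%C * v)) <= e / (1 + normc v) * (`|s - t| * normc v).
  apply: le; apply: (@le_lt_trans _ _ (`|s - t| * (1 + normc v))).
    by rewrite ler_wpM2l// lerDr.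
  by rewrite -ltr_pdivlMr.
have -> : Re (f (z + s%:C%C * v)) - Re (f (z + t%:C%C * v)) - Re (l * v) * (s - t) =
    Re (f (z + s%:C%C * v) - f (z + t%:C%C * v) - l * ((s - t)%:C%C * v)).
  rewrite !Re_sub; congr (_ - _ - _).
  by rewrite mulrCA; case: (l * v) => p q /=; rewrite mul0r subr0 mulrC.
apply: le_trans (Re_le_normc _) _; apply: le_trans le _.
rewrite mulrCA mulrC ler_wpM2r// mulrAC ler_pdivrMr//.
by rewrite ler_pM2l// lerDr.
Qed.

(** The real mean value theorem applied to Re (conj D * f) along the segment,
    where D is the increment of f. *)
Lemma mean_value_ineq f z w (L : R) :
  (forall t : R, 0 <= t <= 1 ->
     exists2 l, cderiv f (z + t%:C%C * (w - z)) l & normc l <= L) ->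
  normc (f w - f z) <= L * normc (w - z).
Proof.
move=> df; set D := f w - f z.
have [->|D0] := eqVneq D 0.
  have [|l _ /(le_trans (normc_ge0 _)) L0] := df 0; first by rewrite lexx ler01.
  by rewrite normc0 mulr_ge0 ?normc_ge0.
have nD : 0 < normc D by rewrite normc_gt0.
have nconj : normc (conjc D) = normc D by case: (D) => x y; rewrite /normc /= sqrrN.
pose h (s : R) := Re ((conjc D) * f (z + s%:C%C * (w - z))).
have dh (t : R) : 0 <= t <= 1 -> exists2 k, is_derive t 1 h k &
    `|k| <= normc D * (L * normc (w - z)).
  move=> /df[l dl lL]; exists (Re (conjc D * l * (w - z))).
    exact: (cderiv_line_re (cderivZ (conjc D) dl)).
  apply: le_trans (Re_le_normc _) _; rewrite !normcM nconj -mulrA.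
  by rewrite ler_wpM2l ?ler_wpM2r ?normc_ge0.
have [||t t01] := @MVT R h (fun t => 'D_1 h t) 0 1 ltr01.
- move=> t; rewrite in_itv /= => /andP[t0 t1].
  by have [|k [? _] _] := dh t; [rewrite !ltW|exact: derivableP].
- apply: derivable_within_continuous => t; rewrite in_itv /= => /dh[k [? _] _].
  by [].
move: t01; rewrite in_itv /= => /andP[t0 t1].
have [|k dk kL] := dh t; first by rewrite !ltW.
rewrite (@derive_val _ _ _ _ _ _ _ dk) subr0 mulr1 => E.
have : h 1 - h 0 = normc D * normc D.
  rewrite /h -Re_sub mul1r mul0r addr0 subrKC -mulrBr -/D.
  by rewrite -expr2; have := @sqr_normc _ D; rewrite mulrC normr_normc -rmorphXn => <-.
rewrite E => kE; move: kL; rewrite kE ger0_norm ?mulr_ge0 ?normc_ge0//.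
by rewrite ler_pM2l.
Qed.

End cauchy_estimate.

(** * Locally uniform limits of holomorphic functions *)

Section weierstrass.
Variable R : realType.
Local Notation C := R[i].
Local Notation Re := complex.Re.
Local Notation Im := complex.Im.

Definition cauchy_seq (u : nat -> C) := forall e : R, 0 < e ->
  exists N, forall n m, (N <= n)%N -> (N <= m)%N -> normc (u n - u m) <= e.

Definition tends_to (u : nat -> C) (l : C) := forall e : R, 0 < e ->
  exists N, forall n, (N <= n)%N -> normc (u n - l) <= e.

Lemma real_cauchy_seq (u : nat -> R) : (forall e : R, 0 < e ->
    exists N, forall n m, (N <= n)%N -> (N <= m)%N -> `|u n - u m| <= e) ->
  exists l, forall e : R, 0 < e -> exists N, forall n, (N <= n)%N -> `|u n - l| <= e.
Proof.
move=> cu.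
have : cvg (u @ \oo).
  apply: cauchy_cvg; apply/cauchy_exP => e e0.
  have [|N NP] := cu (e / 2); first exact: divr_gt0.
  exists (u N), N => // n /= Nn; rewrite /ball /=.
  by apply: le_lt_trans (NP _ _ (leqnn N) Nn) _; lra.
move=> /cvgrPdist_le cvu; exists (lim (u @ \oo)) => e /cvu[N _ NP].
by exists N => n /NP; rewrite distrC.
Qed.

Lemma cauchy_seq_cvg u : cauchy_seq u -> exists l, tends_to u l.
Proof.
move=> cu.
have [x xP] : exists l, forall e : R, 0 < e ->
    exists N, forall n, (N <= n)%N -> `|Re (u n) - l| <= e.
  apply: real_cauchy_seq => e /cu[N NP]; exists N => n m Nn Nm.
  by rewrite -Re_sub (le_trans (Re_le_normc _))// NP.
have [y yP] : exists l, forall e : R, 0 < e ->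
    exists N, forall n, (N <= n)%N -> `|Im (u n) - l| <= e.
  apply: real_cauchy_seq => e /cu[N NP]; exists N => n m Nn Nm.
  by rewrite -Im_sub (le_trans (Im_le_normc _))// NP.
exists (x +i* y)%C => e e0.
have [|N NP] := xP (e / 2); first exact: divr_gt0.
have [|M MP] := yP (e / 2); first exact: divr_gt0.
exists (maxn N M) => n; rewrite geq_max => /andP[/NP hN /MP hM].
apply: le_trans (normc_le_ReIm _) _; rewrite Re_sub Im_sub /=; lra.
Qed.

(** Cauchy's estimate turns uniform convergence into convergence of
    derivatives, uniformly on a smaller disc. Let a be the limit of the
    derivatives at z0: the mean value inequality applied to F m - F n bounds
    the increments of f - F n near z0, and F n has the expected first order
    expansion. *)
Lemma weierstrass (F : nat -> C -> C) (f : C -> C) :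
  (forall n z, normc z < 1 -> exists l, cderiv (F n) z l) ->
  (forall r e : R, r < 1 -> 0 < e -> exists N, forall n z, (N <= n)%N ->
     normc z <= r -> normc (F n z - f z) <= e) ->
  forall z, normc z < 1 -> exists l, cderiv f z l.
Proof.
move=> dF Ff z0 z01; pose rho := (1 - normc z0) / 3.
have rho0 : 0 < rho by rewrite divr_gt0// subr_gt0.
have near (e : R) : 0 < e -> exists N, forall n m w l l', (N <= n)%N -> (N <= m)%N ->
    normc (w - z0) <= rho -> cderiv (F n) w l -> cderiv (F m) w l' ->
    normc (l - l') <= e.
  move=> e0; have [||N NP] := Ff (normc z0 + 2 * rho) (e * rho / 4).
  - by rewrite /rho; lra.
  - by rewrite divr_gt0// mulr_gt0.
  exists N => n m w l l' Nn Nm wz dl dl'.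
  have in_disc z : normc (z - w) <= rho -> normc z <= normc z0 + 2 * rho.
    move=> zw; have -> : z = z0 + (w - z0) + (z - w) by ring.
    apply: le_trans (normcD _ _) _; apply: le_trans (lerD (normcD _ _) zw) _.
    by lra.
  have : normc (l - l') <= 2 * (e * rho / 2) / rho.
    apply: (@cauchy_estimate _ (fun z => F n z - F m z) w) => //.
    - move=> z /in_disc zd; have z1 : normc z < 1.
        by apply: le_lt_trans zd _; rewrite /rho; lra.
      have [k dk] := dF n z z1; have [k' dk'] := dF m z z1.
      by exists (k - k'); exact: cderivB.
    - move=> z /in_disc zd.
      have -> : F n z - F m z = (F n z - f z) - (F m z - f z) by ring.
      apply: le_trans (normcB _ _) _.
      by have := NP n z Nn zd; have := NP m z Nm zd; lra.
    - exact: cderivB.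
  by have -> : 2 * (e * rho / 2) / rho = e by field; rewrite gt_eqF.
have [l lP] := choice (fun n => dF n z0 z01).
have zz : normc (z0 - z0) <= rho by rewrite subrr normc0 ltW.
have [a aP] : exists a, tends_to l a.
  apply: cauchy_seq_cvg => e /near[N NP]; exists N => n m Nn Nm.
  exact: (NP n m z0).
exists a => e e0.
have e4 : 0 < e / 4 by rewrite divr_gt0.
have [N NP] := near _ e4; have [M MP] := aP _ e4.
pose n := maxn N M.
have [d [d0 dP]] := lP n _ e4.
exists (Num.min d rho); split; first by rewrite lt_min d0.
move=> w; rewrite lt_min => /andP[wd wr].
have diff m : (N <= m)%N ->
    normc ((F m w - F n w) - (F m z0 - F n z0)) <= e / 4 * normc (w - z0).
  move=> Nm; apply: (@mean_value_ineq _ (fun z => F m z - F n z)) => t /andP[t0 t1].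
  have tw : normc (z0 + t%:C%C * (w - z0) - z0) <= rho.
    rewrite addrAC subrr add0r normcM normc_real ger0_norm//.
    by apply: le_trans (ltW wr); rewrite ler_piMl ?normc_ge0.
  have t1' : normc (z0 + t%:C%C * (w - z0)) < 1.
    rewrite -[_ + _](subrK z0); apply: le_lt_trans (normcD _ _) _.
    by apply: le_lt_trans (lerD tw (lexx _)) _; rewrite /rho; lra.
  have [k dk] := dF m _ t1'; have [k' dk'] := dF n _ t1'.
  exists (k - k'); first exact: cderivB.
  by apply: NP tw dk dk' => //; exact: leq_maxl.
have w1 : normc w < 1.
  rewrite -[w](subrK z0); apply: le_lt_trans (normcD _ _) _.
  by apply: lt_le_trans (ltr_leD wr (lexx _)) _; rewrite /rho; lra.
have difff : normc ((f w - F n w) - (f z0 - F n z0)) <= e / 4 * normc (w - z0).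
  apply/ler_addgt0Pr => t t0.
  have [||m1 m1P] := Ff (Num.max (normc w) (normc z0)) (t / 2).
  - by rewrite gt_max w1.
  - exact: divr_gt0.
  have Hm : (m1 <= maxn N m1)%N by exact: leq_maxr.
  have H1 := m1P _ w Hm; have H2 := m1P _ z0 Hm.
  move: H1 H2; rewrite !le_max !lexx orbT /= => /(_ isT) H1 /(_ isT) H2.
  have H3 := diff (maxn N m1) (leq_maxl _ _).
  have -> : (f w - F n w) - (f z0 - F n z0) =
    ((F (maxn N m1) w - F n w) - (F (maxn N m1) z0 - F n z0)) -
    (F (maxn N m1) w - f w) + (F (maxn N m1) z0 - f z0) by ring.
  apply: le_trans (normcD _ _) _; apply: le_trans (lerD (normcB _ _) (lexx _)) _.
  by lra.
have -> : f w - f z0 - a * (w - z0) = ((f w - F n w) - (f z0 - F n z0)) +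
   (F n w - F n z0 - l n * (w - z0)) + (l n - a) * (w - z0) by ring.
apply: le_trans (normcD _ _) _; apply: le_trans (lerD (normcD _ _) (lexx _)) _.
rewrite normcM.
have H1 : normc (l n - a) * normc (w - z0) <= e / 4 * normc (w - z0).
  by rewrite ler_wpM2r ?normc_ge0// MP// leq_maxr.
have H2 := dP w wd.
have : 0 <= e * normc (w - z0) by rewrite mulr_ge0 ?normc_ge0// ltW.
lra.
Qed.

End weierstrass.

(** * Hahn-Banach separation over the complex numbers *)

Section hahn_banach.
Variables (R : realType) (V : lmodType R[i]).
Implicit Types (s p u : V -> R) (x y : V).

(** Real scalars act through their embedding into R[i], as the space is only
    given as a complex one. *)
Definition sublinear s := (forall x y, s (x + y) <= s x + s y) /\
  (forall (t : R) x, 0 <= t -> s (t%:C%C *: x) = t * s x).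

Lemma sublinear0 s : sublinear s -> s 0 = 0.
Proof. by move=> [_ /(_ 0 0 (lexx _))]; rewrite scaler0 mul0r. Qed.

(** A sublinear functional is bounded below by this, so the infima below are
    finite. *)
Lemma sublinearN s x : sublinear s -> - s (- x) <= s x.
Proof.
move=> ss; have := ss.1 x (- x).
by rewrite subrr sublinear0//; lra.
Qed.

Lemma inf_le (E : set R) (a : R) (m : R) : E a -> (forall b, E b -> m <= b) -> inf E <= a.
Proof. by move=> Ea mE; apply: ge_inf => //; exists m. Qed.

Section cone_infimum.
Variables (s : V -> R) (P : V -> R -> Prop).
Hypothesis ss : sublinear s.
Hypothesis P0 : P 0 0.
Hypothesis PD : forall c w c' w', P c w -> P c' w' -> P (c + c') (w + w').
Hypothesis PZ : forall (t : R) c w, 0 <= t -> P c w -> P (t%:C%C *: c) (t * w).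
Hypothesis Ps : forall c w, P c w -> w <= s c.

(** The largest sublinear functional below s whose value at - c is at most - w
    for each (c, w) in the cone P. The case of a half-line is the step towards
    minimality in the Hahn-Banach theorem, and a well chosen P prescribes the
    values of the functional on a subspace and at a point. *)
Definition cone_inf x := inf [set r | exists c w, P c w /\ r = s (x + c) - w].

Lemma cone_inf_le x c w : P c w -> cone_inf x <= s (x + c) - w.
Proof.
move=> Pcw; apply: (@inf_le _ _ (- s (- x))); first by exists c, w.
move=> _ [c' [w' [/Ps le ->]]].
have := ss.1 (x + c') (- x); rewrite addrAC subrr add0r; lra.
Qed.

Lemma le_cone_inf x m : (forall c w, P c w -> m <= s (x + c) - w) -> m <= cone_inf x.
Proof.
move=> mP; apply: lb_le_inf; first by exists (s (x + 0) - 0), 0, 0.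
by move=> _ [c [w [Pcw ->]]]; exact: mP.
Qed.

Lemma cone_inf_below x : cone_inf x <= s x.
Proof. by have := cone_inf_le x P0; rewrite addr0 subr0. Qed.

Lemma cone_inf_opp c w : P c w -> cone_inf (- c) <= - w.
Proof.
by move=> /(cone_inf_le (- c)); rewrite addNr sublinear0// sub0r.
Qed.

Lemma cone_inf_sublinear : sublinear cone_inf.
Proof.
have pos (t : R) x : 0 < t -> cone_inf (t%:C%C *: x) <= t * cone_inf x.
  move=> t0; rewrite -ler_pdivrMl//; apply: le_cone_inf => c w Pcw.
  rewrite ler_pdivrMl// mulrBr -ss.2 ?(ltW t0)// scalerDr.
  by apply: cone_inf_le; apply: PZ => //; exact: ltW.
split=> [x y|t x]; last first.
  rewrite le_eqVlt => /predU1P[<-|t0].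
    rewrite scale0r mul0r; apply/eqP; rewrite eq_le; apply/andP; split.
      by have := cone_inf_below 0; rewrite (sublinear0 ss).
    by apply: le_cone_inf => c w /Ps; rewrite add0r subr_ge0.
  apply/eqP; rewrite eq_le pos//=.
  have ti : 0 < t^-1 by rewrite invr_gt0.
  have := pos _ (t%:C%C *: x) ti; rewrite scalerA -rmorphM mulVf ?gt_eqF// scale1r.
  by rewrite ler_pdivlMl.
rewrite -lerBlDr; apply: le_cone_inf => c w Pcw.
rewrite lerBlDr -lerBlDl; apply: le_cone_inf => c' w' Pcw'.
have := cone_inf_le (x + y) (PD Pcw Pcw'); have := ss.1 (x + c) (y + c').
by rewrite addrACA; lra.
Qed.

End cone_infimum.

(** A minimal sublinear functional u below p, given by Zorn's lemma, is
    linear: lowering u along the half-line of h with [cone_inf] cannot change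
    u, which forces u (- h) = - u h. *)
Theorem hahn_banach_dominated p : sublinear p -> exists u,
  [/\ forall x y, u (x + y) = u x + u y,
      forall (t : R) x, u (t%:C%C *: x) = t * u x & forall x, u x <= p x].
Proof.
move=> sp.
pose T := {s | sublinear s /\ forall x, s x <= p x}.
(* reversed order: Zorn's lemma has to produce a minimal functional *)
pose rel (a b : T) := `[< forall x, sval b x <= sval a x >].
have [||A totA|[u [su up]] umin] :=
    @ZL_preorder T (exist _ p (conj sp (fun x => lexx (p x)))) rel.
- by move=> t; apply/asboolP.
- move=> a b c /asboolP ab /asboolP bc; apply/asboolP => x.
  exact: le_trans (ab x).
- have [[s0 As0]|A0] := pselect (exists s : T, A s); last first.
    by exists (exist _ p (conj sp (fun x => lexx (p x)))) => s As; case: A0; exists s.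
  pose m x := inf [set r | exists2 s : T, A s & r = sval s x].
  have mle (s : T) x : A s -> m x <= sval s x.
    move=> As; apply: (@inf_le _ _ (- p (- x))); first by exists s.
    move=> _ [[r [sr rp]] Ar ->] /=.
    by have := sublinearN x sr; have := rp (- x); lra.
  have lem x k : (forall s : T, A s -> k <= sval s x) -> k <= m x.
    move=> kP; apply: lb_le_inf; first by exists (sval s0 x), s0.
    by move=> _ [s As ->]; exact: kP.
  have pos (t : R) x : 0 < t -> m (t%:C%C *: x) <= t * m x.
    move=> t0; rewrite -ler_pdivrMl//; apply: lem => s As.
    rewrite ler_pdivrMl//; have := mle s (t%:C%C *: x) As.
    by rewrite (svalP s).1.2 ?(ltW t0).
  have sm : sublinear m.
    split=> [x y|t x].
      rewrite -lerBlDr; apply: (lem x) => s As.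
      rewrite lerBlDr -lerBlDl; apply: (lem y) => s' As'.
      have [/asboolP ss'|/asboolP ss'] := totA _ _ As As'.
        have := mle s' (x + y) As'; have := (svalP s').1.1 x y; have := ss' x; lra.
      have := mle s (x + y) As; have := (svalP s).1.1 x y; have := ss' y; lra.
    rewrite le_eqVlt => /predU1P[<-|t0].
      rewrite scale0r mul0r; apply/eqP; rewrite eq_le; apply/andP; split.
        by have := mle s0 0 As0; rewrite (sublinear0 (svalP s0).1).
      by apply: lem => s As; rewrite (sublinear0 (svalP s).1).
    apply/eqP; rewrite eq_le pos//=.
    have ti : 0 < t^-1 by rewrite invr_gt0.
    have := pos _ (t%:C%C *: x) ti; rewrite scalerA -rmorphM mulVf ?gt_eqF// scale1r.
    by rewrite ler_pdivlMl.
  have mp x : m x <= p x by apply: le_trans (mle s0 x As0) _; exact: (svalP s0).2.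
  by exists (exist _ m (conj sm mp)) => s As; apply/asboolP => x; exact: mle.
have u0 := sublinear0 su.
have uN h : u (- h) = - u h.
  pose P c w := exists2 t : R, 0 <= t & c = t%:C%C *: h /\ w = t * u h.
  have P0 : P 0 0 by exists 0 => //; rewrite scale0r mul0r.
  have PD c w c' w' : P c w -> P c' w' -> P (c + c') (w + w').
    move=> [t t0 [-> ->]] [t' t'0 [-> ->]]; exists (t + t'); first exact: addr_ge0.
    by rewrite rmorphD scalerDl mulrDl.
  have PZ (t : R) c w : 0 <= t -> P c w -> P (t%:C%C *: c) (t * w).
    move=> t0 [t' t'0 [-> ->]]; exists (t * t'); first exact: mulr_ge0.
    by rewrite rmorphM scalerA mulrA.
  have Ps c w : P c w -> w <= u c by move=> [t t0 [-> ->]]; rewrite su.2.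
  have sP := cone_inf_sublinear su P0 PD PZ Ps.
  have below := cone_inf_below su P0 Ps.
  have /umin/asboolP/= le : rel (exist _ u (conj su up))
      (exist _ _ (conj sP (fun x => le_trans (below x) (up x)))) by apply/asboolP.
  have P1 : P h (u h) by exists 1 => //; rewrite scale1r mul1r.
  apply/eqP; rewrite eq_le; apply/andP; split.
    exact: le_trans (le _) (cone_inf_opp su Ps P1).
  by have := su.1 h (- h); rewrite subrr u0; lra.
have uD x y : u (x + y) = u x + u y.
  apply/eqP; rewrite eq_le su.1/=.
  by have := su.1 (x + y) (- y); rewrite addrK uN; lra.
exists u; split=> // t x; have [t0|t0] := leP 0 t; first exact: su.2.
have -> : t%:C%C *: x = - ((- t)%:C%C *: x) by rewrite rmorphN scaleNr opprK.
by rewrite uN su.2 ?mulNr ?opprK// oppr_ge0 ltW.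
Qed.

(** A real functional u obtained below [cone_inf] for the cone generated by M
    x {0} and (g, 1) vanishes on M and is at least 1 at g. Then x |-> u x - i
    u (i x) is complex linear, and it still vanishes on M because M is stable
    under i. *)
Theorem linear_separation (p : V -> R) (M : V -> Prop) (g : V) :
  (forall x y, p (x + y) <= p x + p y) ->
  (forall (a : R[i]) x, p (a *: x) = normc a * p x) ->
  M 0 -> (forall x y, M x -> M y -> M (x + y)) ->
  (forall (a : R[i]) x, M x -> M (a *: x)) ->
  (forall m, M m -> 1 <= p (g + m)) ->
  exists u : V -> R[i],
   [/\ forall (a : R[i]) x y, u (a *: x + y) = a * u x + u y,
       forall x, normc (u x) <= 2 * p x,
       forall m, M m -> u m = 0 & u g != 0].
Proof.
move=> pD pZ M0 MD MZ pg.
have sp : sublinear p by split=> // t x t0; rewrite pZ normc_real ger0_norm.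
have p_ge0 x : 0 <= p x.
  have := pD x (- x); rewrite subrr (sublinear0 sp) -scaleN1r pZ normc_opp normc1.
  by lra.
pose P c w := exists2 m, M m & 0 <= w /\ c = m + w%:C%C *: g.
have P0 : P 0 0 by exists 0 => //; rewrite scale0r addr0.
have PD c w c' w' : P c w -> P c' w' -> P (c + c') (w + w').
  move=> [m Mm [w0 ->]] [m' Mm' [w'0 ->]]; exists (m + m'); first exact: MD.
  by split; [exact: addr_ge0|rewrite rmorphD scalerDl addrACA].
have PZ (t : R) c w : 0 <= t -> P c w -> P (t%:C%C *: c) (t * w).
  move=> t0 [m Mm [w0 ->]]; exists (t%:C%C *: m); first exact: MZ.
  by split; [exact: mulr_ge0|rewrite rmorphM scalerDr scalerA].
have Ps c w : P c w -> w <= p c.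
  move=> [m Mm [w0 ->]]; have [->|wn0] := eqVneq w 0; first exact: p_ge0.
  have wc0 : w%:C%C != 0 by rewrite fmorph_eq0.
  have -> : m + w%:C%C *: g = w%:C%C *: (g + w%:C%C^-1 *: m).
    by rewrite scalerDr scalerA divff// scale1r addrC.
  rewrite pZ normc_real ger0_norm// ler_peMr// pg//; exact: MZ.
have sP := cone_inf_sublinear sp P0 PD PZ Ps.
have [u [uD uZ uP]] := hahn_banach_dominated sP.
have up x : u x <= p x by apply: le_trans (uP x) (cone_inf_below sp P0 Ps x).
have u0 : u 0 = 0 by have := uZ 0 0; rewrite scaler0 mul0r.
have uN x : u (- x) = - u x by have := uD x (- x); rewrite subrr u0; lra.
have absu x : `|u x| <= p x.
  rewrite ler_norml up andbT lerNl -uN; apply: le_trans (up _) _.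
  by rewrite -scaleN1r pZ normc_opp normc1 mul1r.
have uM m : M m -> u m = 0.
  have le0 m' : M m' -> u (- m') <= 0.
    move=> Mm; apply: le_trans (uP _) _; rewrite -oppr0.
    by apply: (cone_inf_opp sp Ps); exists m' => //; rewrite scale0r addr0.
  move=> Mm; have := le0 _ Mm; have := le0 (- m); rewrite opprK uN.
  by rewrite -scaleN1r => /(_ (MZ _ _ Mm)); lra.
have ug : 1 <= u g.
  have : P g 1 by exists 0 => //; rewrite scale1r add0r ler01.
  by move=> /(cone_inf_opp sp Ps)/(le_trans (uP _)); rewrite uN; lra.
have uC (a b : R) x : u ((a +i* b)%C *: x) = a * u x + b * u ('i%C *: x).
  have -> : (a +i* b)%C = a%:C%C + b%:C%C * 'i%C by rewrite [LHS]complexE /= [X in _ + X]mulrC.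
  by rewrite scalerDl uD -scalerA !uZ.
exists (fun x => (u x -i* u ('i%C *: x))%C); split.
- move=> [a b] x y; rewrite uD (uC a b) scalerDr uD scalerA.
  have -> : 'i%C * (a +i* b)%C = (- b +i* a)%C :> R[i].
    by apply/eqP; rewrite eq_complex /=; apply/andP; split; apply/eqP; ring.
  by rewrite (uC (- b) a); apply/eqP; rewrite eq_complex /=; apply/andP; split; apply/eqP; ring.
- move=> x; apply: le_trans (normc_le_ReIm _) _; rewrite /= normrN.
  have := absu x; have := absu ('i%C *: x); rewrite pZ.
  by rewrite /normc /= expr0n expr1n add0r sqrtr1 mul1r; lra.
- by move=> m Mm; rewrite uM// uM ?oppr0//; exact: MZ.
- by rewrite eq_complex negb_and /= gt_eqF// (lt_le_trans ltr01).
Qed.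

End hahn_banach.

(** * Compact subsets of the unit disk *)

Section disk_topology.
Variable R : realType.
Local Notation C := (R[i]^o).
Local Notation Re := complex.Re.
Local Notation Im := complex.Im.
Local Notation U := (set_type (unit_disk R)).

(** The point of the complex plane, at the type R[i] where the modulus is
    real, instead of the type R[i]^o that carries the topology. *)
Definition pt (z : U) : R[i] := \val z.

Lemma normc_pt (z : U) : normc (pt z) < 1.
Proof. by have := set_valP z; rewrite /unit_disk /= normr_normc -(ltcR _ 1). Qed.

Lemma pt_exists (z : R[i]) : normc z < 1 -> exists w : U, pt w = z.
Proof.
move=> z1; have zU : z \in unit_disk R.
  by apply/mem_set; rewrite /unit_disk /= normr_normc -(ltcR _ 1) in z1 *.
by exists (SigSub zU).
Qed.

Lemma nbhs_diskP (z : U) (N : set U) : nbhs z N <->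
  exists2 e : R, 0 < e & forall w, normc (pt w - pt z) < e -> N w.
Proof.
split=> [[_ [[B oB <-] Bz] BN]|[e e0 eN]].
  have /nbhs_ballP [e /= e0 eB] : nbhs (pt z : C) B by exact: open_nbhs_nbhs.
  have eR : e = (Re e)%:C%C by rewrite RRe_real// gtr0_real.
  exists (Re e); first by move: e0; rewrite eR ltcR.
  move=> w wz; apply: BN; apply: eB; rewrite -ball_normE /= -[`|_|]/((normc _)%:C%C).
  by rewrite normc_sub eR ltcR.
have ec : (0 : R[i]) < e%:C%C by rewrite ltcR.
exists (\val @^-1` ball (pt z : C) e%:C%C).
split.
- by exists (ball (pt z : C) e%:C%C) => //; exact: ball_open.
- exact: (@ballxx _ C).
- move=> w; rewrite -ball_normE /= -[`|_|]/((normc (pt z - pt w))%:C%C).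
  by rewrite ltcR normc_sub; exact: eN.
Qed.

Definition disc (r : R) : set U := [set z | normc (pt z) <= r].

Lemma disc_pt (r : R) (z : U) : disc r z = (normc (pt z) <= r).
Proof. by []. Qed.

(** The map z |-> (Re z, Im z) sends the disc into a compact square; a cluster
    point of the image filter has modulus at most r, hence comes from a point
    of U, which is a cluster point of the given filter. *)
Lemma compact_disc (r : R) : r < 1 -> compact (disc r).
Proof.
move=> r1 F PF Fr.
pose h (z : U) : R * R := (Re (pt z), Im (pt z)).
have cQ : compact (`[- r, r]%classic `*` `[- r, r]%classic : set (R * R)).
  by apply: compact_setX; exact: segment_compact.
have FQ : F (h @^-1` (`[- r, r]%classic `*` `[- r, r]%classic)).
  apply: filterS Fr => z; rewrite /disc /= => zr; split; rewrite /= in_itv /= -ler_norml.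
    exact: le_trans (Re_le_normc _) zr.
  exact: le_trans (Im_le_normc _) zr.
have [[a b] [_ clab]] := cQ (h @ F) _ FQ.
have key (B : set U) (e : R) : F B -> 0 < e ->
    exists z, B z /\ normc (pt z - (a +i* b)%C) < e.
  move=> FB e0.
  have hB : F (h @^-1` (h @` B)) by apply: filterS FB => z Bz; exists z.
  have e2 : 0 < e / 2 by rewrite divr_gt0.
  have nab : nbhs (a, b) (ball a (e / 2) `*` ball b (e / 2)).
    by exists (ball a (e / 2), ball b (e / 2)); [split; exact: nbhsx_ballx|].
  have [_ [[z Bz <-] [/= az bz]]] := clab _ _ hB nab.
  exists z; split=> //; apply: le_lt_trans (normc_le_ReIm _) _.
  move: az bz; rewrite -!ball_normE /= Re_sub Im_sub [`|a - _|]distrC [`|b - _|]distrC /=; lra.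
have cr : normc (a +i* b)%C <= r.
  apply/ler_addgt0Pr => e /(key _ _ Fr)[z [zr ze]].
  have -> : (a +i* b)%C = pt z - (pt z - (a +i* b)%C) by ring.
  by apply: le_trans (normcB _ _) _; rewrite lerD// ltW.
have [c cE] := pt_exists (le_lt_trans cr r1).
exists c; split; first by rewrite disc_pt cE.
move=> B N FB /nbhs_diskP[e e0 eN].
by have [z [Bz ze]] := key B e FB e0; exists z; split=> //; apply: eN; rewrite cE.
Qed.

Lemma compact_sub_disc (K : set U) : compact K -> exists2 r : R, 0 < r < 1 & K `<=` disc r.
Proof.
move=> /compact_near_coveringP cK.
have : \forall r \near (1 : R)^'-, forall y, K y -> normc (pt y) < r.
  apply: cK => y Ky; set m := (1 + normc (pt y)) / 2.
  have y1 := normc_pt y.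
  exists ([set y' | normc (pt y') < m], [set r | m < r]) => /=.
    split; last by apply: nbhs_left_gt; rewrite /m; lra.
    apply/nbhs_diskP; exists (m - normc (pt y)); first by rewrite /m; lra.
    move=> w wy /=; rewrite -[pt w](subrK (pt y)).
    by apply: le_lt_trans (normcD _ _) _; lra.
  by move=> [y' r] /= [h1 h2]; exact: lt_trans h2.
move=> H; near (1 : R)^'- => r.
exists r; last first.
  by move=> y Ky; apply: ltW; move: y Ky; near: r.
by apply/andP; split; near: r; [exact: nbhs_left_gt|exact: nbhs_left_lt].
Unshelve. all: by end_near. Qed.

Lemma disc_le (r s : R) : r <= s -> disc r `<=` disc s.
Proof. by move=> rs z /le_trans; apply. Qed.

End disk_topology.

(** * Weak density *)

Section weak_density.
Variables (R : realType) (E : topologicalLmodType R[i]).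

(** The only form in which weak density is used: finitely many functionals
    define a weak neighbourhood. *)
Lemma weak_dense_approx (S : set E) n (l : 'I_n -> topological_dual E)
    (g : E) (e : R) :
  dense (S : set (weak_space E)) -> 0 < e ->
  exists2 x, S x & forall i, normc (sval (l i) g - sval (l i) x) < e.
Proof.
move=> dS e0.
have FW : Filter (nbhs (g : weak_space E)) by exact: nbhs_filter.
have : nbhs (g : weak_space E)
    [set x : E | forall i, normc (sval (l i) g - sval (l i) x) < e].
  apply: (@filter_forall _ _ _ (nbhs (g : weak_space E)) FW) => i.
  have cl := proj1 (weak_cvgP g FW) cvg_id (l i).
  have ec : (0 : R[i]) < e%:C%C by rewrite ltcR.
  have := proj1 (@cvgrPdist_lt _ R[i]^o _ _ FW _ _) cl e%:C%C ec.
  apply: (@filterS _ (nbhs (g : weak_space E))) => x.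
  by rewrite -[`|_|]/((normc (sval (l i) g - sval (l i) x))%:C%C) ltcR.
rewrite nbhsE => -[W [oW Wg] WP].
have [x [Wx Sx]] := dS W (ex_intro _ (g : weak_space E) Wg) oW.
by exists x => //; exact: WP.
Qed.

Lemma weak_coarser (S : set E) : dense S -> dense (S : set (weak_space E)).
Proof.
move=> dS W W0 oW; apply: dS => //.
rewrite openE => f Wf.
have nW : nbhs (f : weak_space E) W by exact: open_nbhs_nbhs.
have : nbhs f --> (f : weak_space E).
  by apply: (proj2 (weak_cvgP f (nbhs_filter f))) => l; exact: (svalP l).
exact.
Qed.

End weak_density.

(** * The topology of H(U) and its dual *)

Section Hol_theory.
Variable R : realType.
Local Notation C := (R[i]^o).
Local Notation Re := complex.Re.
Local Notation Im := complex.Im.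
Local Notation U := (set_type (unit_disk R)).
Implicit Types (f g : Hol R) (z w : U).

Definition ext (f : U -> C) : R[i] -> R[i] := 'valL_ (0 : C) f.

Lemma extE (f : U -> C) z : ext f (pt z) = f z.
Proof. exact: valLE. Qed.

Lemma Hol_cderiv f (z : R[i]) : normc z < 1 -> exists l, cderiv (ext (\val f)) z l.
Proof.
move=> /pt_exists[w <-]; apply/derivable_cderiv.
exact: (set_mem (valP f)).
Qed.

Lemma holomorphicP (f : U -> C) (G : R[i] -> R[i]) :
  (forall z : R[i], normc z < 1 -> exists l, cderiv G z l) ->
  (forall z, f z = G (pt z)) -> holomorphic f.
Proof.
move=> dG fG z; apply/derivable_cderiv.
have [l dl] := dG _ (normc_pt z); exists l.
apply: (@cderiv_near _ G _ _ _ (1 - normc (pt z))) dl.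
  by rewrite subr_gt0 normc_pt.
move=> w wz; have /pt_exists[w' <-] : normc w < 1.
  by rewrite -[w](subrK (pt z)) (le_lt_trans (normcD _ _))// -ltrBrDr.
by rewrite -[RHS]/(ext f (pt w')) extE fG.
Qed.

Lemma Hol_exists (G : R[i] -> R[i]) :
  (forall z : R[i], normc z < 1 -> exists l, cderiv G z l) ->
  exists f : Hol R, forall z, \val f z = G (pt z).
Proof.
move=> dG; have hG : holomorphic (G \o @pt R : U -> C).
  by apply: holomorphicP dG _.
by exists (Sub (G \o @pt R) (mem_set hG)).
Qed.

(** Continuity of the scaling at (0, f): some nonzero multiple of f is smaller
    than 1 on the disc. *)
Lemma Hol_bounded f (r : R) : r < 1 -> exists2 M : R, 0 < M &
  forall z, disc r z -> normc (\val f z) <= M.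
Proof.
move=> /compact_disc cK.
have [[A B] /= [nA nB] AB] := @Hol_scale_continuous R ((0 : C), f) _
  (nbhs_Hol ((0 : C) *: f) cK ltr01).
have /nbhs_ballP[e /= e0 eA] := nA.
have eR : e = (Re e)%:C%C by rewrite RRe_real// gtr0_real.
have Re0 : 0 < Re e by move: e0; rewrite eR ltcR.
exists (2 / Re e); first by rewrite divr_gt0.
move=> z zr; pose c : R[i] := (Re e / 2)%:C%C.
have nc : normc c = Re e / 2 by rewrite normc_real ger0_norm// divr_ge0// ltW.
have Ac : A c.
  apply: eA; rewrite -ball_normE /= sub0r normrN -[`|_|]/((normc c)%:C%C) nc eR ltcR.
  by lra.
have /= := AB (c, f) (conj Ac (nbhs_singleton nB)) z zr.
rewrite scale0r sub0r normrN -[`|_|]/((normc (c * \val f z))%:C%C).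
rewrite -[1]/(1%:C%C) ltcR normcM nc => H; apply: ltW.
by rewrite ltr_pdivlMr//; lra.
Qed.

Lemma val_HolD f g z : \val (f + g) z = \val f z + \val g z.
Proof. by []. Qed.

Lemma val_HolZ (a : R[i]) f z : \val (a *: f) z = a * \val f z.
Proof. by []. Qed.

Definition disc_near f (r e : R) : set (Hol R) :=
  [set g | forall z, disc r z -> normc (\val f z - \val g z) <= e].

Lemma disc_near_nbhs f (r e : R) : r < 1 -> 0 < e -> nbhs f (disc_near f r e).
Proof.
move=> /compact_disc cK e0; have ec : (0 : R[i]) < e%:C%C by rewrite ltcR.
apply: filterS (nbhs_Hol f cK ec) => g H z /H.
by rewrite -[`|_|]/((normc (\val f z - \val g z))%:C%C) ltcR => /ltW.
Qed.

(** Convergence for the topology of compact convergence is tested on the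
    filter generated by the sets [disc_near f r e]: each compact set lies in a
    disc. *)
Lemma nbhs_disc_near f (N : set (Hol R)) : nbhs f N ->
  exists r e : R, [/\ 0 < r < 1, 0 < e & disc_near f r e `<=` N].
Proof.
move=> [_ [[B oB <-] Bf] BN].
pose F : set_system (Hol R) := fun P =>
  exists r e : R, [/\ 0 < r < 1, 0 < e & disc_near f r e `<=` P].
have FF : Filter F.
  split=> [|P Q|P Q PQ].
  - by exists (1/2), 1; split=> //; lra.
  - move=> [r [e [/andP[r0 r1] e0 P1]]] [s [d [/andP[s0 s1] d0 Q1]]].
    exists (Num.max r s), (Num.min e d); split.
    + by rewrite lt_max r0/= gt_max r1.
    + by rewrite lt_min e0.
    + move=> g gP; split.
        apply: P1 => z zr; apply: le_trans (gP z _) _; last by rewrite ge_min lexx.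
        by apply: disc_le zr; rewrite le_max lexx.
      apply: Q1 => z zr; apply: le_trans (gP z _) _; last by rewrite ge_min lexx orbT.
      by apply: disc_le zr; rewrite le_max lexx orbT.
  - by move=> [r [e [r01 e0 P1]]]; exists r, e; split=> //; exact: subset_trans PQ.
have cvgF : (\val @ F) --> (\val f : {family compact, U -> C}).
  apply/fam_cvgP => K cK A /uniform_nbhs[E [entE EA]].
  move: entE; rewrite -entourage_ballE => -[e /= e0 eE].
  have eR : e = (Re e)%:C%C by rewrite RRe_real// gtr0_real.
  have Re0 : 0 < Re e by move: e0; rewrite eR ltcR.
  have [r r01 Kr] := compact_sub_disc cK.
  exists r, (Re e / 2); split=> //; first by rewrite divr_gt0.
  move=> g gP; apply: EA => y /Kr/gP le; apply: eE => /=.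
  rewrite -ball_normE /= -[`|_|]/((normc (\val f y - \val g y))%:C%C) eR ltcR.
  by apply: le_lt_trans le _; lra.
have [r [e [r01 e0 H]]] : F (\val @^-1` B).
  by apply: cvgF; exact: open_nbhs_nbhs.
by exists r, e; split=> // g /H; exact: BN.
Qed.

Lemma dense_HolP (S : set (Hol R)) :
  (forall f (r e : R), 0 < r < 1 -> 0 < e -> exists2 g, S g & disc_near f r e g) ->
  dense S.
Proof.
move=> dS O [f Of] oO.
have [r [e [r01 e0 eO]]] : exists r e : R, [/\ 0 < r < 1, 0 < e & disc_near f r e `<=` O].
  by apply: nbhs_disc_near; exact: open_nbhs_nbhs.
by have [g Sg gP] := dS f r e r01 e0; exists g; split=> //; exact: eO.
Qed.

(** The only source of continuous functionals: point evaluations, and the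
    functional given by the separation theorem, are bounded by a seminorm of
    uniform convergence on a disc. *)
Lemma dual_exists (u : Hol R -> R[i]) (r c : R) : r < 1 -> 0 < c ->
  (forall (a : R[i]) f g, u (a *: f + g) = a * u f + u g) ->
  (forall f (M : R), (forall z, disc r z -> normc (\val f z) <= M) ->
     normc (u f) <= c * M) ->
  exists l : topological_dual (Hol R), forall f, sval l f = u f.
Proof.
move=> r1 c0 lin bnd.
have uB f g : u (f - g) = u f - u g.
  by rewrite addrC -scaleN1r lin mulN1r addrC.
have linu : linear (u : Hol R -> R[i]^o) by move=> a f g; exact: lin.
pose L := GRing.isLinear.Build R[i] (Hol R) (R[i]^o) _ (u : Hol R -> R[i]^o) linu.
pose ul : {linear Hol R -> R[i]^o} := HB.pack (u : Hol R -> R[i]^o) L.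
have cu : continuous (ul : Hol R -> R[i]^o).
  move=> f.
  apply: (proj2 (@cvgrPdist_le _ C _ _ (nbhs_filter (f : Hol R)) _ _)) => e e0.
  have eR : e = (Re e)%:C%C by rewrite RRe_real// gtr0_real.
  have Re0 : 0 < Re e by move: e0; rewrite eR ltcR.
  apply: filterS (disc_near_nbhs f r1 (divr_gt0 Re0 c0)) => g gP.
  rewrite -[`|_|]/((normc (u f - u g))%:C%C) eR lecR -uB.
  apply: le_trans (bnd (f - g) (Re e / c) gP) _.
  by rewrite mulrC divfK// gt_eqF.
by exists (exist _ ul cu).
Qed.

Lemma eval_dual (z : U) : exists l : topological_dual (Hol R),
  forall f, sval l f = \val f z.
Proof.
apply: (@dual_exists _ (normc (pt z)) 1) => //; first exact: normc_pt.
by move=> f M H; rewrite mul1r; apply: H; rewrite disc_pt.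
Qed.

End Hol_theory.

(** * Seminorms on discs *)

Section disc_seminorm.
Variable R : realType.
Implicit Types f g : Hol R.
Variable r : R.
Hypothesis r01 : 0 < r < 1.

Definition disc_norm f := sup [set normc (\val f z) | z in disc r].

Lemma le_disc_norm f z : disc r z -> normc (\val f z) <= disc_norm f.
Proof.
move=> zr; have /andP[_ r1] := r01; have [M _ MP] := Hol_bounded f r1.
apply: ub_le_sup; last by exists z.
by exists M => _ [w wr <-]; exact: MP.
Qed.

Lemma disc_norm_le f (M : R) :
  (forall z, disc r z -> normc (\val f z) <= M) -> disc_norm f <= M.
Proof.
move=> fM; have /andP[r0 _] := r01.
have [|o oE] := @pt_exists R 0; first by rewrite normc0.
apply: ge_sup; first by exists (normc (\val f o)), o => //; rewrite disc_pt oE normc0 ltW.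
by move=> _ [w wr <-]; exact: fM.
Qed.

Lemma disc_normD f g : disc_norm (f + g) <= disc_norm f + disc_norm g.
Proof.
apply: disc_norm_le => z zr; rewrite val_HolD; apply: le_trans (normcD _ _) _.
by rewrite lerD// le_disc_norm.
Qed.

Lemma disc_normZ (a : R[i]) f : disc_norm (a *: f) = normc a * disc_norm f.
Proof.
have le b h : disc_norm (b *: h) <= normc b * disc_norm h.
  apply: disc_norm_le => z zr.
  rewrite val_HolZ normcM.
  by rewrite ler_wpM2l ?normc_ge0// le_disc_norm.
apply/eqP; rewrite eq_le le/=.
have [->|a0] := eqVneq a 0.
  rewrite normc0 mul0r scale0r; have := le 0 0; rewrite scaler0.
  have [|o oE] := @pt_exists R 0; first by rewrite normc0.
  have od : disc r o by rewrite disc_pt oE normc0; case/andP: r01 => /ltW.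
  by move=> _; exact: le_trans (normc_ge0 _) (le_disc_norm _ od).
have na : 0 < normc a by rewrite normc_gt0.
have := le a^-1 (a *: f); rewrite scalerA mulVf// scale1r normcV.
by rewrite ler_pdivlMl.
Qed.

End disc_seminorm.

(** * Consequences of a weakly dense orbit: dense ranges *)

Section weak_orbit.
Variable R : realType.
Local Notation C := (R[i]^o).
Local Notation Re := complex.Re.
Local Notation U := (set_type (unit_disk R)).
Variables (phi : U -> U) (hphi : holomorphic (\val \o phi : U -> C)).
Local Notation T := (comp_op hphi).
Implicit Types (f g h : Hol R) (z w : U).

Lemma iter_comp_op n f z : \val (iter n T f) z = \val f (iter n phi z).
Proof. by elim: n z => // n IH z; rewrite (iterSr n phi) -IH. Qed.

Lemma iter_comp_opP n (a : R[i]) f g :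
  iter n T (a *: f + g) = a *: iter n T f + iter n T g.
Proof. by elim: n => // n IH; rewrite !iterS IH linearP. Qed.

(** Combinations of the orbit from time n on, as lists so that the
    coefficients can be replaced by rationals later. *)
Definition orbit_comb n (x : Hol R) (s : seq (R[i] * nat)) : Hol R :=
  \sum_(q <- s) q.1 *: iter (q.2 + n) T x.

Lemma orbit_comb_iter n x s : orbit_comb n x s = iter n T (orbit_comb 0 x s).
Proof.
rewrite /orbit_comb; elim: s => [|[a j] s IH].
  by rewrite !big_nil; elim: n => // n IH; rewrite iterS -IH linear0.
by rewrite !big_cons /= iter_comp_opP IH addn0 addnC iterD.
Qed.

Variable x : Hol R.
Hypothesis wdense : dense (operator_orbit T x : set (weak_space (Hol R))).

(** Otherwise a nonzero functional u vanishes on all T^j x with j >= n. The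
    values of u on the orbit are then bounded by B, the sum of the moduli of
    the first n of them, whereas weak density makes them come within 1 of a
    number of modulus B + 1. *)
Lemma orbit_comb_dense n g (r e : R) : 0 < r < 1 -> 0 < e ->
  exists s, disc_near g r e (orbit_comb n x s).
Proof.
move=> r01 e0; apply: contrapT => /forallNP far.
have /andP[r0 r1] := r01.
pose M f := exists s, f = orbit_comb n x s.
pose p f := disc_norm r f / e.
have [|||||m [s ->]|u [lin bnd uM ug]] := @linear_separation R (Hol R) p M g.
- by move=> f h; rewrite /p -mulrDl ler_pM2r ?invr_gt0// disc_normD.
- by move=> a f; rewrite /p disc_normZ// mulrA.
- by exists [::]; rewrite /orbit_comb big_nil.
- by move=> _ _ [s ->] [t ->]; exists (s ++ t); rewrite /orbit_comb big_cat.
- move=> a _ [s ->]; exists [seq (a * q.1, q.2) | q <- s].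
  rewrite /orbit_comb big_map scaler_sumr; apply: eq_bigr => q _.
  by rewrite scalerA.
- rewrite /p ler_pdivlMr// mul1r leNgt; apply/negP => lt.
  apply: (far [seq (- q.1, q.2) | q <- s]) => z zr.
  apply: le_trans (ltW lt); apply: le_trans (le_disc_norm r01 _ zr).
  rewrite le_eqVlt; apply/orP; left; apply/eqP; congr normc.
  rewrite -[LHS]/(\val (g - orbit_comb n x [seq (- q.1, q.2) | q <- s]) z).
  congr (\val _ z); congr (g + _).
  rewrite /orbit_comb big_map -sumrN; apply: eq_bigr => q _.
  by rewrite scaleNr opprK.
have [l lE] : exists l : topological_dual (Hol R), forall f, sval l f = u f.
  apply: (@dual_exists _ u r (2 / e)) => //; first by rewrite divr_gt0.
  move=> f B fB; apply: le_trans (bnd f) _; rewrite /p mulrA mulrAC.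
  by rewrite ler_pM2l ?divr_gt0//; exact: disc_norm_le.
have uZ a f : u (a *: f) = a * u f.
  have u0 : u 0 = 0 by apply: uM; exists [::]; rewrite /orbit_comb big_nil.
  by have := lin a f 0; rewrite addr0 u0 addr0.
pose B := \sum_(i < n) normc (u (iter i T x)).
have B0 : 0 <= B by rewrite sumr_ge0// => i _; exact: normc_ge0.
have nug : 0 < normc (u g) by rewrite normc_gt0.
(* the target k g satisfies |u (k g)| = B + 1 *)
pose k : R[i] := ((B + 1) / normc (u g))%:C%C.
have [y [j _ <-] /(_ ord0)] :=
  @weak_dense_approx R _ _ 1 (fun=> l) (k *: g) 1 wdense ltr01.
rewrite !lE uZ.
have nk : normc (k * u g) = B + 1.
  by rewrite normcM normc_real ger0_norm ?divr_ge0 ?addr_ge0 ?normc_ge0// divfK// gt_eqF.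
have [jn|nj] := ltnP j n.
  have : normc (u (iter j T x)) <= B.
    rewrite /B (bigD1 (Ordinal jn))//= lerDl sumr_ge0// => i _; exact: normc_ge0.
  have := normcB (k * u g - u (iter j T x)) (- u (iter j T x)).
  by rewrite opprK subrK nk normc_opp ; lra.
have -> : u (iter j T x) = 0.
  apply: uM; exists [:: (1, (j - n)%N)].
  by rewrite /orbit_comb big_seq1 scale1r subnK.
by rewrite subr0 nk; apply/negP; rewrite -leNgt lerDr.
Qed.

Lemma iter_range_dense n g (r e : R) : 0 < r < 1 -> 0 < e ->
  exists h, disc_near g r e (iter n T h).
Proof.
move=> r01 e0; have [s sP] := orbit_comb_dense n g r01 e0.
by exists (orbit_comb 0 x s); rewrite -orbit_comb_iter.
Qed.

End weak_orbit.

(** * Maps into the disk with values near the circle *)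

Section nearly_constant.
Variable R : realType.
Local Notation C := (R[i]^o).
Local Notation U := (set_type (unit_disk R)).
Implicit Types (f g h : Hol R) (z w : U).

Lemma bernoulli_ineq (d : R) k : 0 <= d <= 1 -> 1 - k%:R * d <= (1 - d) ^+ k.
Proof.
move=> /andP[d0 d1]; elim: k => [|k IH]; first by rewrite mul0r subr0 expr0.
have d2 : 0 <= 1 - d by rewrite subr_ge0.
rewrite exprS; apply: le_trans (ler_wpM2l d2 IH).
have : 0 <= k%:R * d * d by rewrite !mulr_ge0.
by rewrite -natr1; lra.
Qed.

Lemma normc_segment (z w : R[i]) (r t : R) : normc z <= r -> normc w <= r ->
  0 <= t <= 1 -> normc (z + t%:C%C * (w - z)) <= r.
Proof.
move=> zr wr /andP[t0 t1].
have -> : z + t%:C%C * (w - z) = (1 - t)%:C%C * z + t%:C%C * w.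
  by rewrite rmorphB rmorph1; ring.
apply: le_trans (normcD _ _) _; rewrite !normcM !normc_real.
rewrite (ger0_norm t0) ger0_norm ?subr_ge0//.
have -> : r = (1 - t) * r + t * r by ring.
by rewrite lerD// ler_wpM2l// subr_ge0.
Qed.

(** Discs are convex. *)
Lemma disc_lipschitz f (r L : R) z w : r < 1 ->
  (forall (u l : R[i]), normc u <= r -> cderiv (ext (\val f)) u l -> normc l <= L) ->
  disc r z -> disc r w -> normc (\val f w - \val f z) <= L * normc (pt w - pt z).
Proof.
move=> r1 dL zr wr; rewrite -(extE _ w) -(extE _ z).
apply: mean_value_ineq => t t01.
have tr := normc_segment zr wr t01.
have [l dl] := Hol_cderiv f (le_lt_trans tr r1).
by exists l => //; exact: dL dl.
Qed.

(** Cauchy's estimate for f^(k+1), which is still bounded by 1. For k = 0 it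
    is a plain bound on f'; for large k it is much better where |f| is close
    to 1. *)
Lemma power_deriv_bound f k (r : R) (u l : R[i]) : r < 1 -> normc u <= r ->
  (forall z, normc (\val f z) <= 1) -> cderiv (ext (\val f)) u l ->
  k.+1%:R * normc (ext (\val f) u) ^+ k * normc l <= 4 / (1 - r).
Proof.
move=> r1 ur f1 dl; pose rho := (1 - r) / 2.
have rho0 : 0 < rho by rewrite divr_gt0// subr_gt0.
have disk v : normc (v - u) <= rho -> normc v < 1.
  move=> vu; rewrite -[v](subrK u); apply: le_lt_trans (normcD _ _) _.
  by apply: le_lt_trans (lerD vu ur) _; rewrite /rho; lra.
have -> : 4 / (1 - r) = 2 * 1 / rho by rewrite /rho; field; rewrite subr_eq0 gt_eqF.
have -> : k.+1%:R * normc (ext (\val f) u) ^+ k * normc l =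
    normc (k.+1%:R * ext (\val f) u ^+ k.+1.-1 * l).
  by rewrite !normcM normc_nat normcX.
apply: (@cauchy_estimate _ (fun v => ext (\val f) v ^+ k.+1) u) => //.
- move=> v /disk/(Hol_cderiv f)[a da]; eexists; exact: cderivX da.
- move=> v /disk/pt_exists[z <-]; rewrite normcX extE.
  by rewrite exprn_ile1 ?normc_ge0.
- exact: cderivX.
Qed.

(** Where |f| >= 1 - 1 / (2 (k+1)), Bernoulli's inequality gives |f|^k >= 1/2,
    so [power_deriv_bound] makes f' of order 1 / k. *)
Lemma nearly_constant f k (r : R) z w : r < 1 ->
  (forall z, normc (\val f z) <= 1) ->
  (forall z, disc r z -> 1 - (2 * k.+1%:R)^-1 <= normc (\val f z)) ->
  disc r z -> disc r w ->
  normc (\val f w - \val f z) <= 8 / (1 - r) / k.+1%:R * normc (pt w - pt z).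
Proof.
move=> r1 f1 fr; apply: disc_lipschitz => // u l ur dl.
have K0 : (0 : R) < k.+1%:R by rewrite ltr0n.
have le := power_deriv_bound k r1 ur f1 dl.
have [v vu] := pt_exists (le_lt_trans ur r1).
have fv : 1 - (2 * k.+1%:R)^-1 <= normc (ext (\val f) u).
  by rewrite -vu extE; apply: fr; rewrite disc_pt vu.
have d01 : 0 <= ((2 * k.+1%:R)^-1 : R) <= 1.
  apply/andP; split; first by rewrite invr_ge0 mulr_ge0.
  by rewrite invf_le1 ?mulr_gt0// -natrM ler1n.
have half : 2^-1 <= normc (ext (\val f) u) ^+ k.
  apply: (@le_trans _ _ ((1 - (2 * k.+1%:R)^-1) ^+ k)); last first.
    by rewrite lerXn2r ?nnegrE ?normc_ge0// subr_ge0; case/andP: d01.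
  apply: le_trans (bernoulli_ineq k d01); rewrite invfM.
  have : k%:R * k.+1%:R^-1 <= 1 :> R by rewrite ler_pdivrMr// mul1r ler_nat.
  by rewrite mulrCA; set q := _ * _^-1 => ?; lra.
have -> : 8 / (1 - r) / k.+1%:R = 2 * (4 / (1 - r)) / k.+1%:R by rewrite mulrA -natrM.
rewrite ler_pdivlMr//.
have : k.+1%:R * 2^-1 * normc l <= k.+1%:R * normc (ext (\val f) u) ^+ k * normc l.
  by rewrite ler_wpM2r ?normc_ge0// ler_wpM2l.
move: le; set X := k.+1%:R * _ * _; set D := 4 / _ => le1 le2.
have : normc l * k.+1%:R = 2 * (k.+1%:R * 2^-1 * normc l) by field.
lra.
Qed.

Lemma disc_net (r eta : R) : r < 1 -> 0 < eta -> exists n (p : 'I_n -> U),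
  (forall i, disc r (p i)) /\
  forall z, disc r z -> exists i, normc (pt z - pt (p i)) < eta.
Proof.
move=> r1 eta0.
have /compact_near_coveringP cK := compact_disc r1.
(* finite subsets of the disc, directed by inclusion: covering the disc by small
   balls is then an eventual property *)
pose F : set_system (seq U) := fun P => exists2 s0 : seq U,
  (forall z, z \in s0 -> disc r z) &
  forall s : seq U, (forall z, z \in s -> disc r z) -> {subset s0 <= s} -> P s.
have FF : Filter F.
  split=> [|P Q [s sr sP] [t tr tQ]|P Q PQ [s sr sP]].
  - by exists [::].
  - exists (s ++ t); first by move=> z; rewrite mem_cat => /orP[/sr|/tr].
    move=> v vr sub; split; [apply: sP|apply: tQ] => // z zs; apply: sub.
      by rewrite mem_cat zs.
    by rewrite mem_cat zs orbT.
  - by exists s => // v vr sub; exact/PQ/sP.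
have [s sr sP] : F [set s : seq U | disc r `<=`
    (fun z => exists2 w : U, w \in s & normc (pt z - pt w) < eta)].
  apply: (cK (seq U) F (fun s z => exists2 w, w \in s & normc (pt z - pt w) < eta)).
  move=> y yr.
  exists ([set z | normc (pt z - pt y) < eta], [set s : seq U | y \in s]) => /=.
    split; first by apply/nbhs_diskP; exists eta.
    by exists [:: y] => [z|s _]; [rewrite inE => /eqP->|apply; rewrite inE].
  by move=> [z s] /= [zy ys]; exists y.
case: (pselect (exists z, disc r z)) => [[z0 rz0]|no]; last first.
  exists 0%N, (fun i : 'I_0 => False_rect U (ltac:(by case: i))).
  by split=> [[]|z zr] //; case: no; exists z.
exists (size s), (fun i => nth z0 s i); split.
  by move=> i; apply: sr; exact: mem_nth.
move=> z /(sP s sr (fun _ H => H))[w ws zw].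
have wi : (index w s < size s)%N by rewrite index_mem.
by exists (Ordinal wi); rewrite /= nth_index.
Qed.

End nearly_constant.

(** * Polynomials that separate 0 from 1 *)

Section step_polynomial.
Variable R : realType.
Implicit Types z w : R[i].

(** The cubic with superattracting fixed points 0 and 1, exchanged by z |-> 1
    - z. *)
Definition smoothstep z : R[i] := 3 * z ^+ 2 - 2 * z ^+ 3.

Lemma smoothstep_sym z : smoothstep (1 - z) = 1 - smoothstep z.
Proof. by rewrite /smoothstep; ring. Qed.

Lemma iter_smoothstep_sym n z : iter n smoothstep (1 - z) = 1 - iter n smoothstep z.
Proof. by elim: n => // n IH; rewrite !iterS IH smoothstep_sym. Qed.

Lemma smoothstep_contract z : normc z <= 4^-1 ->
  normc (smoothstep z) <= 7 / 8 * normc z.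
Proof.
move=> z4; have z0 := normc_ge0 z.
have -> : smoothstep z = z * (z * (3 - 2 * z)) by rewrite /smoothstep; ring.
rewrite normcM mulrC ler_wpM2r// normcM.
have -> : 7 / 8 = 4^-1 * (7 / 2) :> R by field.
apply: ler_pM; rewrite ?normc_ge0//.
apply: le_trans (normcB _ _) _.
rewrite normcM !normc_nat; lra.
Qed.

Lemma iter_smoothstep_small n z : normc z <= 4^-1 ->
  normc (iter n smoothstep z) <= (7 / 8) ^+ n.
Proof.
move=> z4.
have : normc (iter n smoothstep z) <= (7 / 8) ^+ n * normc z /\
    normc (iter n smoothstep z) <= 4^-1.
  elim: n => [|n [IH1 IH2]]; first by rewrite expr0 mul1r.
  have c := smoothstep_contract IH2; rewrite iterS; split.
    by apply: le_trans c _; rewrite exprS; move: IH1; set P := _ ^+ n => ?; lra.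
  by have := normc_ge0 (iter n smoothstep z); lra.
move=> [H _]; apply: le_trans H _.
rewrite ler_piMr ?exprn_ge0 ?divr_ge0//.
by apply: le_trans z4 _; lra.
Qed.

Lemma iter_smoothstep_near1 n z : normc (1 - z) <= 4^-1 ->
  normc (1 - iter n smoothstep z) <= (7 / 8) ^+ n.
Proof. by move=> /(iter_smoothstep_small n); rewrite iter_smoothstep_sym. Qed.

Lemma cderiv_iter_smoothstep n (f : R[i] -> R[i]) z :
  (exists l, cderiv f z l) -> exists l, cderiv (fun w => iter n smoothstep (f w)) z l.
Proof.
move=> df; elim: n => [|n [l dl]]; first by [].
by eexists; apply: cderivB; apply: cderivZ; apply: cderivX; exact: dl.
Qed.

Lemma normc_expr_sub1 n z : normc z <= 1 -> normc (1 - z ^+ n) <= n%:R * normc (1 - z).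
Proof.
move=> z1; elim: n => [|n IH]; first by rewrite expr0 subrr normc0 mul0r.
have -> : 1 - z ^+ n.+1 = (1 - z ^+ n) + z ^+ n * (1 - z) by rewrite exprSr; ring.
apply: le_trans (normcD _ _) _; rewrite -natr1 mulrDl lerD// normcM mul1r.
by rewrite ler_piMl ?normc_ge0// normcX exprn_ile1 ?normc_ge0.
Qed.

End step_polynomial.

(** * Running away and topological transitivity *)

Section run_away.
Variable R : realType.
Local Notation C := (R[i]^o).
Local Notation U := (set_type (unit_disk R)).
Variables (phi : U -> U) (hphi : holomorphic (\val \o phi : U -> C)).
Local Notation T := (comp_op hphi).
Implicit Types (f g h : Hol R) (z w : U).
Variable x : Hol R.
Hypothesis wdense : dense (operator_orbit T x : set (weak_space (Hol R))).

(** Weak density against the evaluations at the points of a finite net, with a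
    constant larger than the bound of x on |z| <= t as target, where s < t <
    1: some iterate of phi sends the net outside that disc. The Lipschitz
    bound extends this from the net to the disc, up to t - s. *)
Lemma escape_disc (r s : R) : r < 1 -> s < 1 ->
  exists m, forall z, disc r z -> s <= normc (pt (iter m phi z)).
Proof.
move=> r1 s1.
have [id idE] := @Hol_exists R (fun u => u) (fun u _ => ex_intro _ 1 (cderiv_id u)).
pose t := (1 + s) / 2.
have t1 : t < 1 by rewrite /t; lra.
have [M M0 MP] := Hol_bounded x t1.
have eta0 : 0 < (t - s) * (1 - r) / 4.
  by rewrite divr_gt0// mulr_gt0// /t; lra.
have [n [p [pr net]]] := disc_net r1 eta0.
have [l lP] := choice (fun i => eval_dual (p i)).
have [g gE] := @Hol_exists R (fun=> (M + 1)%:C%C)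
  (fun u _ => ex_intro _ 0 (cderiv_cst _ u)).
have [_ [m _ <-] xP] := @weak_dense_approx R _ _ n l g 1 wdense ltr01.
exists m => z zr.
have ptE w : pt (iter m phi w) = \val (iter m T id) w by rewrite iter_comp_op idE.
have psi1 w : normc (\val (iter m T id) w) <= 1.
  by rewrite iter_comp_op idE ltW// normc_pt.
have lip u v : disc r u -> disc r v ->
    normc (pt (iter m phi v) - pt (iter m phi u)) <= 4 / (1 - r) * normc (pt v - pt u).
  move=> ur vr; rewrite !ptE.
  apply: (disc_lipschitz r1) => // q k qr dk.
  have := power_deriv_bound 0 r1 qr psi1 dk.
  by rewrite expr0 mulr1 mul1r.
have [i zi] := net z zr.
have big : t < normc (pt (iter m phi (p i))).
  rewrite ltNge; apply/negP => small.
  have := xP i; rewrite !lP iter_comp_op gE => lt.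
  have := MP (iter m phi (p i)) small => le.
  have := normcB ((M + 1)%:C%C - \val x (iter m phi (p i))) (- \val x (iter m phi (p i))).
  by rewrite opprK subrK normc_opp normc_real ger0_norm; lra.
have := lip _ _ zr (pr i); rewrite [normc (pt (p i) - _)]normc_sub => le.
have : 4 / (1 - r) * normc (pt z - pt (p i)) <= t - s.
  rewrite mulrAC ler_pdivrMr ?subr_gt0//; lra.
have := normcD (pt (iter m phi (p i)) - pt (iter m phi z)) (pt (iter m phi z)).
by rewrite subrK; lra.
Qed.

(** The image of the disc is close to the circle by [escape_disc], hence has
    small diameter by [nearly_constant]; a is the image of 0. *)
Lemma run_away (r e : R) : 0 < r < 1 -> 0 < e -> exists m (a : R[i]),
  [/\ normc a <= 1, 1 - e <= normc a &
      forall z, disc r z -> normc (pt (iter m phi z) - a) <= e].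
Proof.
move=> /andP[r0 r1] e0.
have [id idE] := @Hol_exists R (fun u => u) (fun u _ => ex_intro _ 1 (cderiv_id u)).
have r2 : 0 < 1 - r by rewrite subr_gt0.
pose X := 8 / (1 - r) / e + e^-1.
pose k := Num.trunc X.
have kX : X < k.+1%:R by exact: truncnS_gt.
have K0 : (0 : R) < k.+1%:R by rewrite ltr0n.
have X1 : 8 / (1 - r) / k.+1%:R <= e.
  rewrite ler_pdivrMr// -ler_pdivrMl// mulrC; apply: le_trans (ltW kX).
  by rewrite lerDl invr_ge0 ltW.
have X2 : (2 * k.+1%:R)^-1 <= e.
  have : e^-1 <= k.+1%:R.
    by apply: le_trans (ltW kX); rewrite lerDr !divr_ge0// ltW.
  move=> eK; rewrite -[leRHS]invrK lef_pV2 ?posrE ?invr_gt0 ?mulr_gt0//.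
  by move: K0 eK; set K := k.+1%:R; lra.
have [m mP] := @escape_disc r (1 - (2 * k.+1%:R)^-1) r1
  ltac:(by rewrite ltrBlDr ltrDl invr_gt0 mulr_gt0).
have [z0 z0E] := @pt_exists R 0 ltac:(by rewrite normc0).
have z0r : disc r z0 by rewrite disc_pt z0E normc0 ltW.
exists m, (pt (iter m phi z0)); split.
- by rewrite ltW// normc_pt.
- by apply: le_trans (mP _ z0r); rewrite lerD2l lerN2.
- have ptE w : pt (iter m phi w) = \val (iter m T id) w by rewrite iter_comp_op idE.
  move=> z zr; rewrite !ptE.
  apply: le_trans (nearly_constant (k := k) r1 _ _ z0r zr) _.
  + by move=> w; rewrite iter_comp_op idE ltW// normc_pt.
  + by move=> w wr; rewrite iter_comp_op idE; exact: mP.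
  + rewrite z0E subr0; apply: le_trans X1.
    by rewrite ler_piMr ?(ltW (normc_pt _))// !divr_ge0// ltW.
Qed.

(** With q close to 0 on the disc and close to 1 on its image under the m-th
    iterate of phi, the function q h + (1 - q) f interpolates between f on the
    disc and h on the image, where T^m h is close to g. The bounds of h and
    T^m f depend on m, so q has to be chosen after m: this is why it is an
    iterate, whose convergence to 0 and 1 only requires the initial polynomial
    to be within 1/4 of these values. *)
Lemma transitivity f g (r e : R) : 0 < r < 1 -> 0 < e ->
  exists m F, disc_near f r e F /\ disc_near g r e (iter m T F).
Proof.
move=> r01 e0; have /andP[r0 r1] := r01.
have [N NP] : exists N, r ^+ N <= 4^-1.
  have [||N /(_ N (leqnn N))/ltW NP] := @expr_small R r 4^-1; last by exists N.
  - by rewrite ltW.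
  - by rewrite invr_gt0.
have N0 : (0 : R) < N.+1%:R by rewrite ltr0n.
(* on the image, 1 - conj a * w is at most (1 - |a|^2) + |w - a| <= 3 d, and
   N * 3 d <= 1/4 *)
pose d : R := (12 * N.+1%:R)^-1.
have d0 : 0 < d by rewrite invr_gt0 mulr_gt0.
have [m [a [a1 ad ma]]] := run_away r01 d0.
have e2 : 0 < e / 2 by rewrite divr_gt0.
have [h hP] := iter_range_dense wdense m g r01 e2.
have [A A0 AP] := Hol_bounded h r1.
have [B B0 BP] := Hol_bounded f r1.
have [A' A'0 A'P] := Hol_bounded (iter m T h) r1.
have [B' B'0 B'P] := Hol_bounded (iter m T f) r1.
pose S := A + B + A' + B'.
have S0 : 0 < S by rewrite !addr_gt0.
have [j jP] : exists j, (7 / 8) ^+ j * S <= e / 2.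
  have [||j /(_ j (leqnn j)) jP] := @expr_small R (7 / 8) (e / 2 / S).
  - by apply/andP; split; lra.
  - by rewrite !divr_gt0.
  by exists j; rewrite -ler_pdivlMr// ltW.
pose c : R := (7 / 8) ^+ j.
have c0 : 0 <= c by rewrite exprn_ge0// divr_ge0.
pose q (u : R[i]) := iter j (@smoothstep R) ((conjc a * u) ^+ N).
have na : normc (conjc a) = normc a by case: (a) => u v; rewrite /normc /= sqrrN.
have q_disc z : disc r z -> normc (q (pt z)) <= c.
  move=> zr; apply: iter_smoothstep_small; apply: le_trans NP.
  rewrite normcX lerXn2r ?nnegrE ?normc_ge0 ?(ltW r0)// normcM na.
  by apply: le_trans zr; rewrite ler_piMl ?normc_ge0.
have q_image z : disc r z -> normc (1 - q (pt (iter m phi z))) <= c.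
  move=> zr; apply: iter_smoothstep_near1.
  set w := pt _; have w1 : normc w <= 1 by rewrite ltW// normc_pt.
  have aw : normc (conjc a * w) <= 1.
    by rewrite normcM na mulr_ile1 ?normc_ge0.
  apply: le_trans (normc_expr_sub1 N aw) _.
  have le3 : normc (1 - conjc a * w) <= 3 * d.
    have -> : 1 - conjc a * w = (1 - conjc a * a) - conjc a * (w - a) by ring.
    have aa : conjc a * a = (normc a ^+ 2)%:C%C.
      by rewrite mulrC -sqr_normc normr_normc rmorphXn.
    rewrite aa; apply: le_trans (normcB _ _) _; rewrite normcM na.
    have -> : 1 - (normc a ^+ 2)%:C%C = (1 - normc a ^+ 2)%:C%C :> R[i].
      by rewrite rmorphB rmorph1.
    have a2 : normc a ^+ 2 <= 1 by rewrite exprn_ile1 ?normc_ge0.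
    rewrite normc_real ger0_norm ?subr_ge0//.
    have h1 : normc a * normc (w - a) <= 1 * d by apply: ler_pM; rewrite ?normc_ge0 ?ma.
    have h2 : (1 - d) * (1 - d) <= normc a ^+ 2.
      by rewrite expr2 ler_pM// subr_ge0 invf_le1 ?mulr_gt0// -natrM ler1n.
    have : 0 <= d * d by rewrite mulr_ge0// ltW.
    by lra.
  apply: (@le_trans _ _ (N.+1%:R * (3 * d))).
    by apply: ler_pM; rewrite ?normc_ge0 ?ler_nat.
  have -> : N.+1%:R * (3 * d) = 3 / 12 * (N.+1%:R / N.+1%:R).
    by rewrite /d invfM; ring.
  by rewrite divff ?gt_eqF// mulr1; lra.
have dF (u : R[i]) : normc u < 1 ->
    exists l, cderiv (fun v => q v * ext (\val h) v + (1 - q v) * ext (\val f) v) u l.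
  move=> z1.
  have [k1 d1] : exists l, cderiv q u l.
    apply: cderiv_iter_smoothstep; eexists; apply: cderivX; apply: cderivZ.
    exact: cderiv_id.
  have [k2 d2] := Hol_cderiv h z1; have [k3 d3] := Hol_cderiv f z1.
  eexists; apply: cderivD; first exact: cderivM d1 d2.
  exact: cderivM (cderivB (cderiv_cst 1 u) d1) d3.
have [F FE] := Hol_exists dF.
exists m, F; split=> z zr.
  rewrite FE !extE.
  have -> : \val f z - (q (pt z) * \val h z + (1 - q (pt z)) * \val f z) =
    q (pt z) * (\val f z - \val h z) by ring.
  rewrite normcM; apply: (@le_trans _ _ (c * S)); last by move: jP; rewrite -/c; lra.
  apply: ler_pM; rewrite ?normc_ge0 ?q_disc//.
  apply: le_trans (normcB _ _) _.
  by have := AP z zr; have := BP z zr; rewrite /S; lra.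
rewrite iter_comp_op FE !extE -!(iter_comp_op hphi).
have -> : \val g z - (q (pt (iter m phi z)) * \val (iter m T h) z +
     (1 - q (pt (iter m phi z))) * \val (iter m T f) z) =
  (\val g z - \val (iter m T h) z) + (1 - q (pt (iter m phi z))) *
   (\val (iter m T h) z - \val (iter m T f) z) by ring.
apply: le_trans (normcD _ _) _.
have := hP z zr; rewrite normcM => le1.
have : normc (1 - q (pt (iter m phi z))) *
   normc (\val (iter m T h) z - \val (iter m T f) z) <= c * S.
  apply: ler_pM; rewrite ?normc_ge0 ?q_image//.
  apply: le_trans (normcB _ _) _.
  by have := A'P z zr; have := B'P z zr; rewrite /S; lra.
by move: jP; rewrite -/c; lra.
Qed.

End run_away.

(** * Construction of a hypercyclic vector *)

Section hypercyclic_vector.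
Variable R : realType.
Local Notation C := (R[i]^o).
Local Notation Re := complex.Re.
Local Notation Im := complex.Im.
Local Notation U := (set_type (unit_disk R)).
Variables (phi : U -> U) (hphi : holomorphic (\val \o phi : U -> C)).
Local Notation T := (comp_op hphi).
Implicit Types (f g h : Hol R) (z w : U).

Definition complex_of_rats (p : rat * rat) : R[i] := (ratr p.1 +i* ratr p.2)%C.

Lemma complex_of_rats_dense (c : R[i]) (e : R) : 0 < e ->
  exists p, normc (c - complex_of_rats p) <= e.
Proof.
move=> e0.
have rat_near (a : R) : exists p : rat, `|a - ratr p| <= e / 2.
  have [|p] := @rat_in_itvoo R (a - e / 2) (a + e / 2); first by lra.
  by rewrite in_itv /= => /andP[? ?]; exists p; rewrite ler_norml; apply/andP; split; lra.
have [p pP] := rat_near (Re c); have [q qP] := rat_near (Im c).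
exists (p, q); apply: le_trans (normc_le_ReIm _) _.
by rewrite Re_sub Im_sub /=; lra.
Qed.

Definition rat_comb (x : Hol R) (s : seq ((rat * rat) * nat)) : Hol R :=
  orbit_comb hphi 0 x [seq (complex_of_rats q.1, q.2) | q <- s].

Lemma disc_nearD f f' g g' (r e e' : R) : disc_near f r e g -> disc_near f' r e' g' ->
  disc_near (f + f') r (e + e') (g + g').
Proof.
move=> fg fg' z zr.
rewrite !val_HolD opprD addrACA; apply: le_trans (normcD _ _) _.
by rewrite lerD ?fg ?fg'.
Qed.

Lemma rat_comb_near x s (r e : R) : r < 1 -> 0 < e ->
  exists s', disc_near (orbit_comb hphi 0 x s) r e (rat_comb x s').
Proof.
move=> r1; elim: s e => [|[a j] s IH] e e0.
  by exists [::] => z _; rewrite /rat_comb /= subrr normc0 ltW.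
have e2 : 0 < e / 2 by rewrite divr_gt0.
have [s' s'P] := IH _ e2.
have [B B0 BP] := Hol_bounded (iter (j + 0) T x) r1.
have [p pP] := complex_of_rats_dense a (divr_gt0 e2 B0).
exists ((p, j) :: s').
rewrite /rat_comb /orbit_comb map_cons !big_cons /= (splitr e).
apply: disc_nearD => // z zr.
rewrite !val_HolZ -mulrBl normcM.
apply: le_trans (ler_pM _ _ pP (BP z zr)) _; rewrite ?normc_ge0//.
by rewrite divfK// gt_eqF.
Qed.

(** An enumeration of the rational combinations of the orbit in which each one
    occurs infinitely often: a list is coded together with an arbitrary
    number, so it has infinitely many codes. *)
Definition target (x : Hol R) (k : nat) : Hol R :=
  if unpickle k is Some q then rat_comb x (q : seq ((rat * rat) * nat) * nat).1 else 0.

Lemma injective_unbounded (f : nat -> nat) : injective f -> forall K, exists i, (K <= f i)%N.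
Proof.
move=> injf K; apply: contrapT => /forallNP no.
have lt i : (f i < K)%N by rewrite ltnNge; apply/negP/no.
have inj : injective (fun i : 'I_K.+1 => Ordinal (lt i)).
  by move=> i j [] /injf /val_inj.
by have := leq_card _ inj; rewrite !card_ord ltnn.
Qed.

(** Arbitrarily late approximations are needed, since the k-th step of the
    construction only achieves precision 2^-k. *)
Lemma target_recurrent x : dense (operator_orbit T x : set (weak_space (Hol R))) ->
  forall g (r e : R) K, 0 < r < 1 -> 0 < e ->
  exists2 k, (K <= k)%N & disc_near g r e (target x k).
Proof.
move=> dx g r e K r01 e0; have /andP[_ r1] := r01.
have e2 : 0 < e / 2 by rewrite divr_gt0.
have [s sP] := orbit_comb_dense dx 0 g r01 e2.
have [s' s'P] := rat_comb_near x s r1 e2.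
have [|i iK] := @injective_unbounded (fun i => pickle (s', i)) _ K.
  by move=> i j /(pcan_inj pickleK)[].
exists (pickle (s', i)) => // z zr; rewrite /target pickleK /=.
apply: le_trans (normc_triangle (\val (orbit_comb hphi 0 x s) z) _ _) _.
by rewrite (splitr e) lerD// ?sP// s'P.
Qed.

Lemma iter_disc_bounded m (r : R) : r < 1 -> exists2 s : R, s < 1 &
  forall z, disc r z -> disc s (iter m phi z).
Proof.
move=> r1.
have cphi : continuous phi.
  apply: (@continuous_comp_initial _ U C \val phi).
  exact: holomorphic_continuous.
have cit : continuous (iter m phi).
  elim: m => [|m IH] z; first exact: cvg_id.
  by apply: (@continuous_comp _ _ _ (iter m phi) phi); [exact: IH|exact: cphi].
have : compact (iter m phi @` disc r).
  by apply: continuous_compact; [exact: continuous_subspaceT|exact: compact_disc].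
move=> /compact_sub_disc[s /andP[_ s1] sP].
by exists s => // z zr; apply: sP; exists z.
Qed.

Lemma geometric_cauchy (F : nat -> Hol R) (rho : nat -> R) :
  (forall k, rho k <= rho k.+1) ->
  (forall k, disc_near (F k) (rho k) (2^-1 ^+ k) (F k.+1)) ->
  forall n m z, (n <= m)%N -> disc (rho n) z ->
    normc (\val (F n) z - \val (F m) z) <= 2 * 2^-1 ^+ n - 2 * 2^-1 ^+ m.
Proof.
move=> rhoS FS n m z nm zn.
have rho_le k : rho n <= rho (n + k)%N.
  by elim: k => [|k IH]; [rewrite addn0|rewrite addnS; exact: le_trans IH _].
rewrite -(subnKC nm); elim: (m - n)%N => [|k IH].
  by rewrite addn0 !subrr normc0.
apply: le_trans (normc_triangle (\val (F (n + k)%N) z) _ _) _.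
have zk : disc (rho (n + k)%N) z by apply: disc_le zn; exact: rho_le.
have := FS _ z zk; rewrite addnS exprS; set u := 2^-1 ^+ (n + k) in IH *.
by move: IH; lra.
Qed.

Lemma Hol_limit (F : nat -> Hol R) (rho : nat -> R) :
  (forall k, rho k <= rho k.+1) ->
  (forall r : R, r < 1 -> exists K, forall k, (K <= k)%N -> r <= rho k) ->
  (forall k, disc_near (F k) (rho k) (2^-1 ^+ k) (F k.+1)) ->
  exists f, forall k, disc_near f (rho k) (2 * 2^-1 ^+ k) (F k).
Proof.
move=> rhoS rho1 FS.
have Fcauchy := geometric_cauchy rhoS FS.
have small (e : R) : 0 < e -> exists N, forall n, (N <= n)%N -> 2 * 2^-1 ^+ n <= e.
  move=> e0; have [||N NP] := @expr_small R 2^-1 (e / 2).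
  - by apply/andP; split; lra.
  - by rewrite divr_gt0.
  by exists N => n /NP; lra.
have pos n : 0 <= 2^-1 ^+ n :> R by rewrite exprn_ge0// invr_ge0.
have lim z : exists l, tends_to (fun k => \val (F k) z) l.
  apply: cauchy_seq_cvg => e e0.
  have [K KP] := rho1 _ (normc_pt z); have [N NP] := small _ e0.
  exists (maxn K N) => n m; rewrite !geq_max => /andP[Kn Nn] /andP[Km Nm].
  have [nm|mn] := leqP n m.
    apply: le_trans (Fcauchy n m z nm (KP n Kn)) _.
    by have := NP n Nn; have := pos m; lra.
  rewrite normc_sub; apply: le_trans (Fcauchy m n z (ltnW mn) (KP m Km)) _.
  by have := NP m Nm; have := pos n; lra.
have [f0 f0P] := choice lim.
have near k z : disc (rho k) z -> normc (f0 z - \val (F k) z) <= 2 * 2^-1 ^+ k.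
  move=> zk; apply/ler_addgt0Pr => e /(f0P z)[N NP].
  have H1 := NP _ (leq_maxr k N); have H2 := Fcauchy _ _ z (leq_maxl k N) zk.
  have := normc_triangle (\val (F (maxn k N)) z) (f0 z) (\val (F k) z).
  rewrite normc_sub in H1; rewrite normc_sub in H2.
  by have := pos (maxn k N); lra.
have hf0 : holomorphic (f0 : U -> C).
  move=> z; apply/derivable_cderiv; rewrite -/(ext f0) -/(pt z).
  apply: (@weierstrass R (fun n => ext (\val (F n))) (ext f0)); last exact: normc_pt.
    by move=> n u; exact: Hol_cderiv.
  move=> r e r1 e0; have [K KP] := rho1 _ r1; have [N NP] := small _ e0.
  exists (maxn K N) => n u; rewrite geq_max => /andP[Kn Nn] ur.
  have [w wu] := pt_exists (le_lt_trans ur r1).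
  rewrite -wu !extE normc_sub; apply: le_trans (near n w _) _; last exact: NP.
  by rewrite disc_pt wu; apply: le_trans ur _; exact: KP.
by exists (Sub (f0 : U -> C) (mem_set hf0)) => k z /near.
Qed.

(** The steps of the construction are pairs (F, rho) of a function and a
    radius. Step k uses transitivity to move F by at most 2^-k on the disc of
    radius rho and to bring it close to the k-th target there at some time m;
    the new radius also has to exceed the modulus of the m-th iterate of phi
    on the old disc, so that the later changes of F do not spoil this
    approximation. *)
Theorem weakly_hypercyclic_hypercyclic :
  weakly_hypercyclic T -> hypercyclic T.
Proof.
move=> [cT [x dx]]; split=> //.
pose S := {p : Hol R * R | 0 < p.2 < 1}.
pose good k (p q : S) := [/\ (sval p).2 <= (sval q).2, 1 - 2^-1 ^+ k <= (sval q).2,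
  disc_near (sval p).1 (sval p).2 (2^-1 ^+ k) (sval q).1 &
  exists m, disc_near (target x k) (sval p).2 (2^-1 ^+ k) (iter m T (sval q).1) /\
    forall z, disc (sval p).2 z -> disc (sval q).2 (iter m phi z)].
have step (kp : nat * S) : exists q, good kp.1 kp.2 q.
  case: kp => k [[F rho] /= rho01].
  have k0 : 0 < 2^-1 ^+ k :> R by rewrite exprn_gt0// invr_gt0.
  have [m [F' [F'1 F'2]]] := transitivity dx F (target x k) rho01 k0.
  have /andP[rho0 rho1] := rho01.
  have [s s1 sP] := iter_disc_bounded m rho1.
  (* s bounds the m-th iterate of phi on the old disc; 1 - 2^-k makes the radii
     tend to 1 *)
  pose rho' := Num.max (Num.max rho (1 - 2^-1 ^+ k)) s.
  have rho'01 : 0 < (F', rho').2 < 1.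
    by rewrite /= !lt_max rho0/= !gt_max rho1 s1 andbT/= ltrBlDr ltrDl.
  exists (exist _ (F', rho') rho'01); split=> /=.
  - by rewrite !le_max lexx.
  - by rewrite !le_max lexx orbT.
  - exact: F'1.
  - exists m; split=> // z /sP; apply: disc_le.
    by rewrite !le_max lexx orbT.
have [next nextP] := choice step.
have half01 : 0 < ((0 : Hol R), 2^-1 : R).2 < 1 by apply/andP; split => /=; lra.
pose q0 : S := exist (fun p : Hol R * R => is_true (0 < p.2 < 1)) (0, 2^-1) half01.
pose q := nat_rect (fun=> S) q0 (fun k p => next (k, p)).
have qP k : good k (q k) (q k.+1) := nextP (k, q k).
pose F k := (sval (q k)).1; pose rho k := (sval (q k)).2.
have rhoS k : rho k <= rho k.+1 by have [] := qP k.
have small (e : R) : 0 < e -> exists N, forall n, (N <= n)%N -> 2^-1 ^+ n < e.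
  by move=> e0; apply: expr_small => //; apply/andP; split; lra.
have rho1 r : r < 1 -> exists K, forall k, (K <= k)%N -> r <= rho k.
  move=> r1; have [|N NP] := small (1 - r); first by rewrite subr_gt0.
  exists N.+1 => -[//|k] /NP lt; have [_ le _ _] := qP k.
  by apply: le_trans le; lra.
have FS k : disc_near (F k) (rho k) (2^-1 ^+ k) (F k.+1) by have [] := qP k.
have [f fP] := Hol_limit rhoS rho1 FS.
exists f; apply: dense_HolP => g r e r01 e0; have /andP[_ r1] := r01.
have [K KP] := rho1 _ r1.
have e4 : 0 < e / 4 by rewrite divr_gt0.
have [N NP] := small _ e4.
have [k] := target_recurrent dx g (maxn K N) r01 e4.
rewrite geq_max => /andP[Kk Nk] gk.
have [_ _ _ [m [dm sm]]] := qP k.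
exists (iter m T f); first by exists m.
move=> z zr; have zk : disc (rho k) z by apply: disc_le zr; exact: KP.
have h1 := gk z zr; have h2 := dm z zk.
have := fP k.+1 _ (sm z zk); rewrite -!(iter_comp_op hphi) normc_sub exprS => h3.
have := normc_triangle (\val (target x k) z) (\val g z) (\val (iter m T f) z).
have := normc_triangle (\val (iter m T (F k.+1)) z) (\val (target x k) z)
  (\val (iter m T f) z).
by have := NP k Nk; move: h2 h3; rewrite -/(F k.+1); set u := _ ^+ k; lra.
Qed.

End hypercyclic_vector.

Theorem theorem4p1 (R : realType) (phi : unit_disk R -> unit_disk R)
    (phi_holo : holomorphic (\val \o phi)) :
  hypercyclic (comp_op phi_holo) <->
  weakly_hypercyclic (comp_op phi_holo).
Proof.
split; last exact: weakly_hypercyclic_hypercyclic.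
by move=> [cT [x dx]]; split=> //; exists x; exact: weak_coarser.
Qed.
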